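(* Let $q$ be a prime power, $F$ a field of characteristic $p>0$ not dividing $q$, $m=m(p,q)$ and $G_n=\mathrm{GL}(n,q)$. Let $(k,i)$ be a middle index for $n$. Then $$H^n_{k,i}\,=\,\bigoplus_{t\in\mathbb{Z}} M^n_{k+tm}\;-\;\bigoplus_{t\in\mathbb{Z}} M^n_{k-i+tm}$$ as $FG_n$-modules in the Burnside ring (of $\mathrm{GL}(n,q)$ over $F$).
   Context: For $i\ge 1$ put $[i]_q=1+q+\dots+q^{i-1}$, and let $m=m(p,q):=\min\{i>1 : [i]_q=0 \text{ in } F\}$. For integers $n\ge 0$ and $k$ let $L^n_k$ be the set of $k$-dimensional subspaces of $\mathbb{F}_q^n$ and let $M^n_k=FL^n_k$ be the $F$-vector space with basis $L^n_k$ ($M^n_k=0$ if $k<0$ or $k>n$). The group $G_n=\mathrm{GL}(n,q)$ permutes $L^n_k$, so $M^n_k$ is an $FG_n$-permutation module. The incidence map $\partial:M^n_k\to M^n_{k-1}$ is the linear map sending $x\in L^n_k$ to the sum of all $(k-1)$-dimensional subspaces of $x$; it commutes with $G_n$ and satisfies $\partial^m=0$. For $0<i<m$ the incidence homology is the $FG_n$-module $$H^n_{k,i}:=(\ker\partial^i\cap M^n_k)\,/\,\partial^{m-i}(M^n_{k+m-i}).$$ A pair of integers $(k,i)$ is a middle index for $n$ if $0\le k\le n$, $0<i<m$ and $n<2k+m-i<n+m$. The formula expresses $H^n_{k,i}$ as an alternating sum of the permutation modules $M^n_j$. *)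

(* Defs.v *)
From HB Require Import structures.
From mathcomp Require Import all_boot all_order all_algebra all_fingroup.
From mathcomp Require Import ring_quotient mxrepresentation.
From mathcomp Require Import boolp classical_sets fsbigop.
From mathcomp Require Import freeg.

Set Implicit Arguments.
Unset Strict Implicit.
Unset Printing Implicit Defensive.

Import Order.TTheory GRing.Theory Num.Theory.
Local Open Scope ring_scope.

Definition qint (F : fieldType) (q i : nat) : F := \sum_(j < i) q%:R ^+ j.

(* m = min {i > 1 : [i]_q = 0 in F} *)
Definition is_quantum_char (F : fieldType) (q m : nat) : Prop :=
  [/\ (1 < m)%N, qint F q m = 0 &
      forall i : nat, (1 < i)%N -> qint F q i = 0 -> (m <= i)%N].

Definition middle_index (n m : nat) (k : int) (i : nat) : Prop :=
  [/\ 0 <= k <= n%:Z, (0 < i < m)%N &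
      n%:Z < 2 * k + m%:Z - i%:Z < n%:Z + m%:Z].

(* The library's 'GL_n[K] is GL_(max n 1); the type below is also correct
   (trivial) for n = 0. *)
Section GeneralLinearGroup.
Variables (K : finFieldType) (n : nat).

Definition GLmx : predArgType := {A : 'M[K]_n | A \in unitmx}.

HB.instance Definition _ := Finite.on GLmx.

Lemma GLmx_mul_subproof (A B : GLmx) : val A *m val B \in unitmx.
Proof. by rewrite unitmx_mul (valP A) (valP B). Qed.

Lemma GLmx_one_subproof : (1%:M : 'M[K]_n) \in unitmx.
Proof. exact: unitmx1. Qed.

Lemma GLmx_inv_subproof (A : GLmx) : invmx (val A) \in unitmx.
Proof. by rewrite unitmx_inv (valP A). Qed.

Definition GLmx_mul (A B : GLmx) : GLmx := Sub (val A *m val B) (GLmx_mul_subproof A B).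
Definition GLmx_one : GLmx := Sub 1%:M GLmx_one_subproof.
Definition GLmx_inv (A : GLmx) : GLmx := Sub (invmx (val A)) (GLmx_inv_subproof A).

Lemma GLmx_mulA : associative GLmx_mul.
Proof. by move=> A B C; apply: val_inj; rewrite !SubK mulmxA. Qed.

Lemma GLmx_mul1 : left_id GLmx_one GLmx_mul.
Proof. by move=> A; apply: val_inj; rewrite !SubK mul1mx. Qed.

Lemma GLmx_mulV : left_inverse GLmx_one GLmx_inv GLmx_mul.
Proof. by move=> A; apply: val_inj; rewrite !SubK mulVmx ?(valP A). Qed.

HB.instance Definition _ :=
  Finite_isGroup.Build GLmx GLmx_mulA GLmx_mul1 GLmx_mulV.

End GeneralLinearGroup.

Import VectorInternalTheory. (* the subType structure of {vspace vT} *)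

HB.instance Definition _ (K : finFieldType) (n : nat) :=
  [Countable of {vspace 'rV[K]_n} by <:].
HB.instance Definition _ (K : finFieldType) (n : nat) :=
  [Finite of {vspace 'rV[K]_n} by <:].

(* The modules M^n_k are realised inside one FG_n-module M^n, with basis the
   set of all subspaces of K^n; elements of M^n are row vectors and G_n acts
   on the right. *)
Section Incidence.
Variables (F : fieldType) (K : finFieldType) (n : nat).

Local Notation L := {vspace 'rV[K]_n}.
Local Notation N := #|{: L}|.
Local Notation G := [set: GLmx K n]%G.

Definition subspace_act (U : L) (g : GLmx K n) : L :=
  (linfun (mulmxr (val g)) @: U)%VS.

Definition bvec (U : L) : 'rV[F]_N := delta_mx 0 (enum_rank U).

(* The matrix whose rows are the images of the basis vectors under f. *)
Definition mx_of_basis (f : L -> 'rV[F]_N) : 'M[F]_N :=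
  \matrix_(a < N) f (enum_val a).

Lemma mul_bvec (U : L) (f : L -> 'rV[F]_N) : bvec U *m mx_of_basis f = f U.
Proof. by rewrite -rowE rowK enum_rankK. Qed.

Lemma eq_mx_bvec (A B : 'M[F]_N) :
  (forall U, bvec U *m A = bvec U *m B) -> A = B.
Proof.
move=> AB; apply/row_matrixP=> a; rewrite !rowE.
by have := AB (enum_val a); rewrite /bvec enum_valK.
Qed.

Definition total_mx (g : GLmx K n) : 'M[F]_N :=
  mx_of_basis (fun U => bvec (subspace_act U g)).

Lemma subspace_act1 (U : L) : subspace_act U 1%g = U.
Proof.
rewrite /subspace_act; set f := linfun _.
suff -> : f = \1%VF by rewrite lim1g.
by apply/lfunP=> v; rewrite lfunE /= mulmx1 id_lfunE.
Qed.

Lemma subspace_actM (U : L) (g h : GLmx K n) :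
  subspace_act U (g * h)%g = subspace_act (subspace_act U g) h.
Proof.
rewrite /subspace_act -limg_comp; congr (_ @: _)%VS.
by apply/lfunP=> v; rewrite comp_lfunE !lfunE /= mulmxA.
Qed.

Lemma total_mx_repr : mx_repr G total_mx.
Proof.
split=> [|g h _ _]; apply: eq_mx_bvec => U.
  by rewrite mul_bvec subspace_act1 mulmx1.
by rewrite mulmxA !mul_bvec subspace_actM.
Qed.

Definition total_repr : mx_representation F G N := MxRepresentation total_mx_repr.

Definition bd : 'M[F]_N :=
  mx_of_basis (fun U =>
    \sum_(V : L | (V <= U)%VS && ((\dim V).+1 == \dim U)) bvec V).

(* Integer degrees, so that this is 0 for k < 0 and for k > n. *)
Definition M (k : int) : 'M[F]_N :=
  (\sum_(U : L | (\dim U)%:Z == k) <<bvec U>>)%MS.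

Lemma subspace_actS (U V : L) (g : GLmx K n) :
  (subspace_act V g <= subspace_act U g)%VS = (V <= U)%VS.
Proof.
apply/idP/idP; last exact: limgS.
move/(limgS (linfun (mulmxr (val g^-1%g)))).
by rewrite -!/(subspace_act _ g^-1%g) -!subspace_actM mulgV !subspace_act1.
Qed.

Lemma dim_subspace_act (U : L) (g : GLmx K n) : \dim (subspace_act U g) = \dim U.
Proof.
have le V h : (\dim (subspace_act V h) <= \dim V)%N by rewrite -[leqRHS](limg_ker_dim (linfun (mulmxr (val h)))) leq_addl.
apply/eqP; rewrite eqn_leq le /=.
by have := le (subspace_act U g) g^-1%g; rewrite -subspace_actM mulgV subspace_act1.
Qed.

Lemma bd_cent (g : GLmx K n) : bd *m total_mx g = total_mx g *m bd.
Proof.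
apply: eq_mx_bvec => U; rewrite !mulmxA !mul_bvec mulmx_suml.
have actK h : cancel (subspace_act^~ h) (subspace_act^~ h^-1%g).
  by move=> V; rewrite -subspace_actM mulgV subspace_act1.
have actVK h : cancel (subspace_act^~ h^-1%g) (subspace_act^~ h).
  by move=> V; rewrite -subspace_actM mulVg subspace_act1.
rewrite [RHS](reindex (subspace_act^~ g)) /=; last first.
  by exists (subspace_act^~ g^-1%g) => V _; rewrite ?actK ?actVK.
apply: eq_big => [V | V _]; first by rewrite subspace_actS !dim_subspace_act.
by rewrite mul_bvec.
Qed.

Lemma bdX_cent (j : nat) : centgmx total_repr (bd ^+ j).
Proof.
apply/centgmxP=> g _ /=; elim: j => [|j IHj]; first by rewrite expr0 mulmx1 mul1mx.
rewrite exprS -[_ * _]/(bd *m _) -mulmxA IHj !mulmxA.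
by rewrite bd_cent.
Qed.

Lemma M_module (k : int) : mxmodule total_repr (M k).
Proof.
apply/mxmoduleP=> g _; rewrite sumsmxMr_gen; apply/sumsmx_subP=> U dU.
rewrite genmxE (eqmxMr _ (genmxE _)) mul_bvec.
by rewrite (sumsmx_sup (subspace_act U g)) ?genmxE ?dim_subspace_act.
Qed.

Definition cycles (k : int) (i : nat) : 'M[F]_N :=
  (kermx (bd ^+ i) :&: M k)%MS.

Definition boundaries (k : int) (j : nat) : 'M[F]_N := M (k + j%:Z) *m bd ^+ j.

Lemma cycles_module (k : int) (i : nat) : mxmodule total_repr (cycles k i).
Proof.
by rewrite capmx_module ?M_module // kermx_centg_module ?bdX_cent.
Qed.

Lemma boundaries_module (k : int) (j : nat) : mxmodule total_repr (boundaries k j).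
Proof.
apply/mxmoduleP=> g Gg.
rewrite -mulmxA (centgmxP (bdX_cent j) g Gg) mulmxA submxMr //.
exact: (mxmoduleP (M_module _)).
Qed.

Definition M_repr (k : int) : mx_representation F G (\rank (M k)) :=
  submod_repr (M_module k).

(* section_repr of U and V is the subquotient (U + V) / U. *)
Definition homology_repr (m : nat) (k : int) (i : nat) :=
  section_repr (boundaries_module k (m - i)) (cycles_module k i).

End Incidence.

(* Grothendieck group of finite-dimensional FG-modules: the free abelian group
   on the modules, modulo [B] - [A] - [C] for every short exact sequence
   0 -> A -> B -> C -> 0 (with C = 0 this identifies isomorphic modules).
   Modulo split sequences only, H^n_{k,i} = (+) M_{k+tm} - (+) M_{k-i+tm} can
   fail: for n = m = 2 and k = i = 1 it would make M_1 isomorphic to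
   H + M_0 + M_2 = H + F + F, but M_1 has only a line of G-fixed vectors. *)
Section GrothendieckGroup.
Variables (F : fieldType) (gT : finGroupType) (G : {group gT}).

Definition fgmod : Type := {d : nat & mx_representation F G d}.

HB.instance Definition _ := gen_eqMixin fgmod.
HB.instance Definition _ := gen_choiceMixin fgmod.

Definition fgmod_of (d : nat) (rG : mx_representation F G d) : fgmod :=
  existT _ d rG.

Definition short_exact (A B C : fgmod) : Prop :=
  exists (f : 'M[F]_(projT1 A, projT1 B)) (h : 'M[F]_(projT1 B, projT1 C)),
    [/\ {in G, forall x, projT2 A x *m f = f *m projT2 B x},
        {in G, forall x, projT2 B x *m h = h *m projT2 C x},
        row_free f, row_full h & (f == kermx h)%MS].

Inductive ses_relation : {freeg fgmod} -> Prop :=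
| ses_relation0 : ses_relation 0
| ses_relation_gen A B C :
    short_exact A B C -> ses_relation (<< B >> - << A >> - << C >>)
| ses_relationB x y : ses_relation x -> ses_relation y -> ses_relation (x - y).

Definition ses_pred : {pred {freeg fgmod}} := fun x => `[< ses_relation x >].

Lemma ses_pred_closed : zmod_closed ses_pred.
Proof.
split=> [|x y /asboolP Rx /asboolP Ry]; apply/asboolP.
  exact: ses_relation0.
exact: ses_relationB.
Qed.

HB.instance Definition _ :=
  GRing.isZmodClosed.Build {freeg fgmod} ses_pred ses_pred_closed.

Definition groth_group : zmodType := Quotient.quot ses_pred.

Definition groth_class (d : nat) (rG : mx_representation F G d) : groth_group :=
  \pi_(Quotient.quot ses_pred)%qT << fgmod_of rG >>.

End GrothendieckGroup.

(* Main.v *)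
Require Import Defs.
From HB Require Import structures.
From mathcomp Require Import all_boot all_order all_algebra all_fingroup.
From mathcomp Require Import ring_quotient finfield mxrepresentation.
From mathcomp Require Import boolp classical_sets fsbigop freeg.
From mathcomp Require Import zify ring.

(** Fix a hyperplane [W] of [V]. Chains on subspaces of [V] split into
    - chains on subspaces of [W] together with their lifts [A |-> sum of the
      U <= V with U :&: W = A, U not in W]; here the boundary map acts as on
      [W], twisted by the scalars [q ^ (dim W - k)], and
    - for every further hyperplane [B] of [V], copies of the chains of
      [B :&: W] (of dimension [dim V - 2], degree shifted by 1).
    Both pieces are centred at the same degree as [V], so by induction on
    [dim V] the incidence homology vanishes outside the middle indices. The
    complex M_{k+m} -> M_{k+j} -> M_k -> M_{k-i} -> ... (i + j = m, boundary
    maps alternately [bd ^+ i] and [bd ^+ j]) contains exactly one middle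
    position, and the formula is its Euler characteristic. *)

Set Implicit Arguments.
Unset Strict Implicit.
Unset Printing Implicit Defensive.

Import Order.TTheory GRing.Theory Num.Theory.
Local Open Scope ring_scope.

(** * Counting hyperplanes and complements *)

Section Hyperplanes.
Variables (K : finFieldType) (n : nat).
Local Notation L := {vspace 'rV[K]_n}.
Implicit Types (A B H S T U V W : L).

Definition hyper W V := (W <= V)%VS && ((\dim W).+1 == \dim V).

Lemma hyperS W V : hyper W V -> (W <= V)%VS.
Proof. by case/andP. Qed.

Lemma hyper_dim W V : hyper W V -> \dim V = (\dim W).+1.
Proof. by case/andP=> _ /eqP. Qed.

Lemma hyper_nsub W V : hyper W V -> ~~ (V <= W)%VS.
Proof. by move=> h; apply/negP=> /dimvS; rewrite (hyper_dim h) ltnn. Qed.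

Lemma hyper_add W V U :
  hyper W V -> (U <= V)%VS -> ~~ (U <= W)%VS -> (U + W)%VS = V.
Proof.
move=> h sUV nUW; apply/eqP; rewrite eqEdim subv_add sUV (hyperS h) /=.
rewrite (hyper_dim h) ltn_neqAle (dimvS (addvSr _ _)) andbT.
rewrite (dimv_leqif_eq (addvSr U W)).
by apply: contra nUW => /eqP {1}->; exact: addvSl.
Qed.

Lemma hyper_cap W V U :
  hyper W V -> (U <= V)%VS -> ~~ (U <= W)%VS -> hyper (U :&: W) U.
Proof.
move=> h sUV nUW; rewrite /hyper capvSl /=.
have := dimv_sum_cap U W; rewrite (hyper_add h sUV nUW) (hyper_dim h).
lia.
Qed.

Lemma nsub_hyper_cap W V U A : hyper W V -> (U <= V)%VS -> ~~ (U <= W)%VS ->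
  (U :&: W)%VS = A -> hyper A U.
Proof. by move=> h sUV nUW <-; exact: hyper_cap h sUV nUW. Qed.

Lemma hyper_eq W W' V : hyper W V -> hyper W' V -> (W <= W')%VS -> W = W'.
Proof.
move=> h h' s; apply/eqP; rewrite eqEdim s /=.
by rewrite -ltnS -(hyper_dim h) -(hyper_dim h').
Qed.

Lemma hyper_nsub_neq W W' V : hyper W V -> hyper W' V -> W != W' -> ~~ (W <= W')%VS.
Proof. by move=> h h'; apply: contra => /(hyper_eq h h') ->. Qed.

Lemma exists_hyper S V : (S <= V)%VS -> S != V ->
  exists2 T, (S <= T)%VS & hyper T V.
Proof.
have [d] := ubnP (\dim V - \dim S)%N; elim: d S => // d IHd S.
rewrite ltnS => led sSV neSV.
have /subvPn[v vV vS]: ~~ (V <= S)%VS.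
  by apply: contra neSV => sVS; rewrite eqEsubv sSV.
have v0 : v != 0 by apply: contraNneq vS => ->; rewrite mem0v.
have sS1V : (S + <[v]> <= V)%VS by rewrite subv_add sSV.
have dS1 : \dim (S + <[v]>) = (\dim S).+1.
  have := dimv_sum_cap S <[v]>; rewrite dim_vline v0.
  suff -> : (S :&: <[v]>)%VS = 0%VS by rewrite dimv0; lia.
  apply/eqP; rewrite -subv0; apply/subvP=> w.
  rewrite memv_cap => /andP[wS /vlineP[c wE]]; rewrite memv0 wE scaler_eq0.
  rewrite (negPf v0) orbF; apply: contraNT vS => c0.
  by rewrite -[v](scalerK c0) -wE memvZ.
have [E|neS1] := eqVneq (S + <[v]>)%VS V.
  by exists S => //; rewrite /hyper sSV -E dS1 /=.
have lt1 : (\dim (S + <[v]>) < \dim V)%N.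
  by rewrite ltn_neqAle dimvS // andbT (dimv_leqif_eq sS1V).
have lt2 : (\dim V - \dim (S + <[v]>) < d)%N by lia.
have [T sST hT] := IHd _ lt2 sS1V neS1.
by exists T => //; apply: subv_trans sST; exact: addvSl.
Qed.

Lemma card_vspaceE U : #|U| = (#|K| ^ \dim U)%N.
Proof. exact: card_vspace. Qed.

(** Double counting of pairs (U, w) with w in W and v + w in U, for a fixed v in V outside W. For
    each U the admissible w form a coset of A. Conversely v + w lies in exactly one U, namely A +
    <[v + w]>. *)
Lemma card_compl W V A : hyper W V -> (A <= W)%VS ->
  #|[set U : L | [&& (U <= V)%VS, ~~ (U <= W)%VS & (U :&: W)%VS == A]]|
    = (#|K| ^ (\dim W - \dim A))%N.
Proof.
move=> h sAW; set X := [set U : L | _].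
have XE U : (U \in X) = [&& (U <= V)%VS, ~~ (U <= W)%VS & (U :&: W)%VS == A].
  by rewrite inE.
have /subvPn[v vV vW] := hyper_nsub h.
have q0 : (0 < #|K|)%N by rewrite (ltn_trans _ (finNzRing_gt1 K)).
apply/eqP; rewrite -(eqn_pmul2r (m := #|K| ^ \dim A)) ?expn_gt0 ?q0 //.
rewrite -expnD subnK ?dimvS // -!card_vspaceE.
have fib U : U \in X -> #|[set w | (w \in W) && (v + w \in U)]| = #|A|.
  rewrite XE => /and3P[sUV nUW /eqP cA].
  have : v \in (U + W)%VS by rewrite (hyper_add h sUV nUW).
  case/memv_addP=> u uU [w wW vE].
  rewrite -(card_imset (mem A) (addIr (- w))); apply: eq_card => x.
  have vU : v - w \in U by rewrite vE addrK.
  have AE y : (y \in A) = (y \in U) && (y \in W) by rewrite -cA memv_cap.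
  apply/idP/imsetP=> [|[y]].
    rewrite inE => /andP[xW vxU]; exists (x + w); last by rewrite addrK.
    rewrite -[_ \in _]/(x + w \in A) AE (memvD xW wW) andbT.
    have -> : x + w = v + x - (v - w) by rewrite opprB [RHS]addrC addrA subrK addrC.
    by rewrite memvB.
  rewrite -[_ \in _]/(y \in A) AE => /andP[yU yW] ->; rewrite inE (memvB yW wW) /=.
  by rewrite addrCA memvD.
have one w : w \in W -> (\sum_(U in X) ((v + w)%R \in U) = 1)%N.
  move=> wW; set u := v + w.
  have uW : u \notin W.
    by apply: contra vW => uW; rewrite -[v](addrK w) memvB.
  have uV : u \in V by rewrite memvD // (subvP (hyperS h)).
  have sU0 : (A + <[u]> <= V)%VS.
    by rewrite subv_add (subv_trans sAW (hyperS h)).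
  have nU0 : ~~ (A + <[u]> <= W)%VS by rewrite subv_add sAW.
  have cU0 : ((A + <[u]>) :&: W)%VS = A.
    apply/eqP; rewrite eqEsubv subv_cap addvSl sAW /= andbT.
    apply/subvP=> x; rewrite memv_cap => /andP[/memv_addP[a aA [b /vlineP[c ->]] ->]].
    move=> xW; have := memvB xW (subvP sAW _ aA); rewrite addrAC subrr add0r.
    have [->|c0 ucW] := eqVneq c 0; first by rewrite scale0r addr0.
    by case/negP: uW; rewrite -[u](scalerK c0) memvZ.
  have X0 : (A + <[u]>)%VS \in X by rewrite XE sU0 nU0 cU0 eqxx.
  rewrite (bigD1 _ X0) big1 => [|U /andP[XU neU]].
    by rewrite /= addn0 (subvP (addvSr A <[u]>)) ?memv_line.
  apply/eqP; rewrite eqb0; apply: contra neU => uU.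
  move: (XU : U \in X); rewrite XE => /and3P[sUV nUW /eqP cA]; rewrite eq_sym eqEdim.
  rewrite (hyper_dim (nsub_hyper_cap h sUV nUW cA)).
  rewrite (hyper_dim (nsub_hyper_cap h sU0 nU0 cU0)) leqnn andbT.
  by rewrite subv_add -{1}cA capvSl.
have -> : (#|X| * #|A| = \sum_(U in X) \sum_(w in W) ((v + w)%R \in U))%N.
  rewrite -sum_nat_const; apply: eq_bigr => U XU; rewrite -(fib U XU).
  rewrite -sum1_card big_mkcond [RHS]big_mkcond; apply: eq_bigr => w _.
  by rewrite inE; case: (w \in W); case: (_ \in U).
rewrite exchange_big /= (eq_bigr (fun=> 1%N)) => [|w wW]; last exact: one.
by rewrite sum1_card.
Qed.

(** Induction on the codimension of S' in V. Choose a hyperplane V' of V containing S'. The map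
    sending B to B :&: V' lands in the same set for V', and each of its fibres has q elements by
    [card_compl]. *)
Lemma card_hyper S S' V : hyper S S' -> (S' <= V)%VS ->
  #|[set B : L | [&& hyper B V, (S <= B)%VS & ~~ (S' <= B)%VS]]|
    = (#|K| ^ (\dim V - \dim S'))%N.
Proof.
move=> hS; have [d] := ubnP (\dim V - \dim S')%N.
elim: d V => // d IHd V; rewrite ltnS => led sSV.
have [<-|neV] := eqVneq S' V.
  rewrite subnn expn0; apply/eqP/cards1P; exists S; apply/setP=> B.
  rewrite !inE; apply/and3P/eqP=> [[hB sSB _]|->]; last by rewrite subvv hyper_nsub.
  exact/esym/(hyper_eq hS hB).
have [V' sV' hV] := exists_hyper sSV neV.
have dV := hyper_dim hV; have dS := dimvS sV'.
have lt1 : (\dim V' - \dim S' < d)%N by lia.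
have := IHd V' lt1 sV'; set X' := [set B | _] => cX'.
set X := [set B | _].
have capX B : B \in X -> (B :&: V')%VS \in X' /\ ~~ (B <= V')%VS.
  rewrite !inE => /and3P[hB sSB nB].
  have sSV' := subv_trans (hyperS hS) sV'.
  have neB : B != V' by apply: contraNneq nB => ->.
  have nBV : ~~ (B <= V')%VS by apply: hyper_nsub_neq hB hV neB.
  split=> //; rewrite subv_cap sSB sSV' /= subv_cap (negPf nB) /= andbT.
  by rewrite capvC (hyper_cap hB) ?(hyperS hV) ?(hyper_nsub_neq hV hB) // eq_sym.
rewrite -sum1_card (partition_big (fun B => B :&: V')%VS (mem X')) /=; last first.
  by move=> B /capX[].
rewrite (eq_bigr (fun=> #|K|)) => [|B' XB'].
  by rewrite sum_nat_const cX' -expnSr; congr (_ ^ _)%N; lia.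
move: (XB'); rewrite inE => /and3P[hB' sSB' nB'].
have qE : (#|K| ^ (\dim V' - \dim B'))%N = #|K|.
  by rewrite (hyper_dim hB') subSnn expn1.
rewrite sum1_card -[RHS]qE -(card_compl hV (hyperS hB')); apply: eq_card => B.
rewrite unfold_in [in RHS]inE; apply/andP/and3P=> [[XB /eqP cB]|[sBV nBV /eqP cB]].
  have [_ nBV] := capX _ XB; split; rewrite ?cB //.
  by move: XB; rewrite inE => /andP[/hyperS].
split; last by rewrite cB.
rewrite inE; apply/and3P; split.
- rewrite /hyper sBV dV (hyper_dim (nsub_hyper_cap hV sBV nBV cB)).
  by rewrite (hyper_dim hB') /=.
- by rewrite (subv_trans sSB') // -cB capvSl.
- by apply: contra nB' => sSB; rewrite -cB subv_cap sSB.
Qed.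

End Hyperplanes.

(** * Chains and lifts from a hyperplane *)

Section Chains.
Variables (F : fieldType) (K : finFieldType) (n : nat).
Local Notation L := {vspace 'rV[K]_n}.
Local Notation N := #|{: L}|.
Local Notation q := (#|{: K}|%:R : F).
Local Notation bd := (bd F K n).
Local Notation bvec := (@bvec F K n).
Implicit Types (A B H S T U V W : L) (k : int).

(** With [hyper_add_pair], this gives a bijection used to compute the boundary of a lift: for fixed
    A, a flag U' < U with U :&: W = A and U' not in W is recovered from U' alone as U = A + U'. *)
Lemma hyper_cap_pair W V U U' : hyper W V -> (U <= V)%VS -> hyper U' U ->
    ~~ (U' <= W)%VS ->
  hyper (U' :&: W) (U :&: W) /\ (U :&: W + U')%VS = U.
Proof.
move=> hW sUV hU nU'.
have nU : ~~ (U <= W)%VS by apply: contra nU' => /(subv_trans (hyperS hU)).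
have hA := hyper_cap hW sUV nU.
have nA : ~~ (U :&: W <= U')%VS.
  by apply: contra nU' => /(hyper_eq hA hU) <-; exact: capvSr.
split; last exact: hyper_add hU (capvSl _ _) nA.
have := hyper_cap hU (capvSl _ _) nA.
by rewrite capvC capvA (capv_idPl (hyperS hU)).
Qed.

Lemma hyper_add_pair W V A U' : hyper W V -> (A <= W)%VS -> (U' <= V)%VS ->
    ~~ (U' <= W)%VS -> hyper (U' :&: W) A ->
  ((A + U') :&: W)%VS = A /\ hyper U' (A + U').
Proof.
move=> hW sAW sU'V nU' hA.
have sV : (A + U' <= V)%VS by rewrite subv_add sU'V (subv_trans sAW (hyperS hW)).
have nW : ~~ (A + U' <= W)%VS by rewrite subv_add (negPf nU') andbF.
have capE : (A :&: U')%VS = (U' :&: W)%VS.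
  apply/eqP; rewrite eqEsubv !subv_cap capvSr capvSl (hyperS hA).
  by rewrite (subv_trans (capvSl _ _) sAW).
have dU := dimv_sum_cap A U'; rewrite capE (hyper_dim hA) in dU.
have hU : hyper U' (A + U') by rewrite /hyper addvSr; apply/eqP; lia.
split=> //; apply/esym/eqP; rewrite eqEdim subv_cap addvSl sAW /=.
have dUW := hyper_dim (hyper_cap hW sV nW).
have dUW' := hyper_dim (hyper_cap hW sU'V nU').
have := hyper_dim hA; have := hyper_dim hU; lia.
Qed.

(** The chains of every V live in one ambient module, so a single matrix [bd] serves all V and the
    induction on the dimension of V changes no types. *)
Definition chains V k : 'M[F]_N :=
  (\sum_(U : L | (U <= V)%VS && ((\dim U)%:Z == k)) <<bvec U>>)%MS.

Lemma chains_full k : chains fullv k = M F K n k.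
Proof. by apply: eq_bigl => U; rewrite subvf. Qed.

Lemma bvec_chains V k U : (U <= V)%VS -> (\dim U)%:Z = k -> (bvec U <= chains V k)%MS.
Proof.
by move=> sUV dU; rewrite (sumsmx_sup U) ?genmxE // sUV dU eqxx.
Qed.

Lemma chainsM_sub V k p r (A : 'M[F]_(N, p)) (B : 'M[F]_(r, p)) :
    (forall U, (U <= V)%VS -> (\dim U)%:Z = k -> (bvec U *m A <= B)%MS) ->
  (chains V k *m A <= B)%MS.
Proof.
move=> AB; rewrite /chains sumsmxMr_gen; apply/sumsmx_subP=> U /andP[sUV /eqP dU].
by rewrite genmxE (eqmxMr _ (genmxE _)) AB.
Qed.

Lemma chains_sub V k r (B : 'M[F]_(r, N)) :
    (forall U, (U <= V)%VS -> (\dim U)%:Z = k -> (bvec U <= B)%MS) ->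
  (chains V k <= B)%MS.
Proof.
by move=> sB; rewrite -[chains _ _]mulmx1 chainsM_sub // => U *; rewrite mulmx1 sB.
Qed.

Lemma chains_ext V k r (x : 'M[F]_(r, N)) p (A B : 'M[F]_(N, p)) :
    (x <= chains V k)%MS ->
    (forall U, (U <= V)%VS -> (\dim U)%:Z = k -> bvec U *m A = bvec U *m B) ->
  x *m A = x *m B.
Proof.
move=> xV AB; apply/eqP; rewrite -subr_eq0 -mulmxBr -submx0.
apply: submx_trans (submxMr _ xV) _; apply: chainsM_sub => U sUV dU.
by rewrite mulmxBr AB // subrr sub0mx.
Qed.

Lemma chainsS W V k : (W <= V)%VS -> (chains W k <= chains V k)%MS.
Proof.
by move=> sWV; apply: chains_sub => U sUW dU; rewrite bvec_chains // (subv_trans sUW).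
Qed.

Lemma chains_out V k : ~~ (0 <= k <= (\dim V)%:Z) -> chains V k = 0.
Proof.
move=> nk; rewrite /chains big_pred0 // => U; apply/negP=> /andP[/dimvS dU /eqP dk].
by case/negP: nk; rewrite -dk lez_nat dU.
Qed.

Lemma bdE U : bvec U *m bd = \sum_(A | hyper A U) bvec A.
Proof. exact: mul_bvec. Qed.

Lemma bd_chains V k r (x : 'M[F]_(r, N)) :
  (x <= chains V k)%MS -> (x *m bd <= chains V (k - 1))%MS.
Proof.
move=> xV; apply: submx_trans (submxMr _ xV) _; apply: chainsM_sub => U sUV dU.
rewrite bdE summx_sub // => A hA; rewrite bvec_chains //.
  exact: subv_trans (hyperS hA) sUV.
by have := hyper_dim hA; lia.
Qed.

Lemma mulmxXS r (x : 'M[F]_(r, N)) (A : 'M[F]_N) j :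
  x *m A ^+ j.+1 = x *m A *m A ^+ j.
Proof. by rewrite exprS -[_ * _]/(A *m _) mulmxA. Qed.

Lemma mulmxXSr r (x : 'M[F]_(r, N)) (A : 'M[F]_N) j :
  x *m A ^+ j.+1 = x *m A ^+ j *m A.
Proof. by rewrite exprSr -[_ * _]/(_ *m A) mulmxA. Qed.

Lemma mulmxXD r (x : 'M[F]_(r, N)) (A : 'M[F]_N) i j :
  x *m A ^+ (i + j) = x *m A ^+ i *m A ^+ j.
Proof. by rewrite exprD -[_ * _]/(_ *m _) mulmxA. Qed.

Lemma bdX_chains V k r (x : 'M[F]_(r, N)) j :
  (x <= chains V k)%MS -> (x *m bd ^+ j <= chains V (k - j%:Z))%MS.
Proof.
move=> xV; elim: j => [|j IHj]; first by rewrite expr0 mulmx1 subr0.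
have -> : k - j.+1%:Z = k - j%:Z - 1 by lia.
by rewrite mulmxXSr bd_chains.
Qed.

Definition hlift W V : 'M[F]_N := mx_of_basis (fun A =>
  \sum_(U : L | [&& (U <= V)%VS, ~~ (U <= W)%VS & (U :&: W)%VS == A]) bvec U).

Lemma liftE W V A : bvec A *m hlift W V =
  \sum_(U : L | [&& (U <= V)%VS, ~~ (U <= W)%VS & (U :&: W)%VS == A]) bvec U.
Proof. exact: mul_bvec. Qed.

Lemma lift_chains W V k r (x : 'M[F]_(r, N)) : hyper W V ->
  (x <= chains W k)%MS -> (x *m hlift W V <= chains V (k + 1))%MS.
Proof.
move=> hW xV; apply: submx_trans (submxMr _ xV) _; apply: chainsM_sub => A sAW dA.
rewrite liftE summx_sub // => U /and3P[sUV nU /eqP cU]; rewrite bvec_chains //.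
by have := hyper_dim (nsub_hyper_cap hW sUV nU cU); lia.
Qed.

(** Each U in the lift of A has exactly one hyperplane inside W, namely A itself; [card_compl]
    counts how often it occurs. The remaining hyperplanes U' of the various U are exactly the terms
    of the lifts of the hyperplanes of A. *)
Lemma bvec_lift_bd W V A : hyper W V -> (A <= W)%VS ->
  bvec A *m hlift W V *m bd =
    q ^+ (\dim W - \dim A) *: bvec A + bvec A *m bd *m hlift W V.
Proof.
move=> hW sAW; rewrite liftE bdE !mulmx_suml.
under [LHS]eq_bigr => U /and3P[sUV nU /eqP cU].
  rewrite bdE (bigID (fun U' => (U' <= W)%VS)) /=.
  have hA := nsub_hyper_cap hW sUV nU cU.
  rewrite (big_pred1 A) => [|U']; last first.
    apply/andP/eqP=> [[hU' sU']|->]; last by rewrite hA.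
    apply: (hyper_eq hU' hA); rewrite -cU subv_cap sU' andbT; exact: hyperS hU'.
  over.
rewrite big_split /= sumr_const; congr (_ + _).
  rewrite -scaler_nat -natrX; congr (_%:R *: _).
  by rewrite -(card_compl hW sAW); apply: eq_card => U; rewrite inE.
under [RHS]eq_bigr => A' _ do rewrite liftE.
rewrite !pair_big_dep /=.
(* Pairs (U, U') with U :&: W = A correspond to pairs (A', U') with A' = U' :&: W, the inverse being
   U = A + U'. *)
rewrite (reindex_onto (fun p : L * L => ((A + p.2)%VS, p.2))
                      (fun p : L * L => ((p.2 :&: W)%VS, p.2))) /=; last first.
  move=> [U U'] /= /andP[/and3P[sUV nU /eqP cU] /andP[hU nU']].
  by have [_] := hyper_cap_pair hW sUV hU nU'; rewrite cU => ->.
apply: eq_bigl => -[A' U'] /=; rewrite xpair_eqE eqxx andbT.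
apply/idP/idP.
  case/andP=> /andP[/and3P[sV nW /eqP cA] /andP[hU nU']] /eqP cU'.
  have [] := hyper_cap_pair hW sV hU nU'; rewrite cA cU' => -> _ /=.
  by rewrite nU' eqxx (subv_trans (addvSr A U') sV).
case/andP=> hA' /and3P[sU'V nU' /eqP cU'].
have := hyper_add_pair hW sAW sU'V nU'; rewrite cU' => /(_ hA')[-> ->].
rewrite !eqxx nU' !andbT !subv_add sU'V (subv_trans sAW (hyperS hW)).
by rewrite (negPf nU') andbF.
Qed.

Hypothesis q_neq0 : q != 0.

Lemma qexpzE V k A : (A <= V)%VS -> (\dim A)%:Z = k ->
  q ^+ (\dim V - \dim A) = q ^ ((\dim V)%:Z - k).
Proof. by move=> /dimvS dA <-; rewrite subzn. Qed.

Lemma lift_bd W V k r (x : 'M[F]_(r, N)) : hyper W V -> (x <= chains W k)%MS ->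
  x *m hlift W V *m bd = q ^ ((\dim W)%:Z - k) *: x + x *m bd *m hlift W V.
Proof.
move=> hW xW; rewrite -!mulmxA -[in X in _ = X + _](mulmx1 x) scalemxAr -mulmxDr.
apply: chains_ext xW _ => A sAW dA.
by rewrite mulmxDr -scalemxAr mulmx1 !mulmxA bvec_lift_bd // (qexpzE sAW dA).
Qed.

(** Iterating [lift_bd], the scalar gains a factor q each time the degree drops by one, so the
    scalars add up to a geometric sum. For i = 0 the predecessor is harmless since [[0]_q]
    vanishes. *)
Lemma lift_bdX W V k r (x : 'M[F]_(r, N)) i : hyper W V -> (x <= chains W k)%MS ->
  x *m hlift W V *m bd ^+ i = x *m bd ^+ i *m hlift W V
     + (q ^ ((\dim W)%:Z - k) * qint F #|{: K}| i) *: (x *m bd ^+ i.-1).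
Proof.
move=> hW xW; elim: i => [|i IHi].
  by rewrite /qint big_ord0 mulr0 scale0r addr0 !expr0 !mulmx1.
rewrite mulmxXSr IHi mulmxDl (lift_bd hW (bdX_chains i xW)).
have -> : qint F #|{: K}| i.+1 = qint F #|{: K}| i + q ^+ i.
  by rewrite /qint big_ord_recr.
have -> : (q ^ ((\dim W)%:Z - k) * qint F #|{: K}| i) *: (x *m bd ^+ i.-1) *m bd
    = (q ^ ((\dim W)%:Z - k) * qint F #|{: K}| i) *: (x *m bd ^+ i).
  case: i {IHi} => [|i]; last by rewrite -scalemxAl -mulmxXSr.
  by rewrite /qint big_ord0 mulr0 !scale0r mul0mx.
have -> : (\dim W)%:Z - (k - i%:Z) = (\dim W)%:Z - k + i by lia.
rewrite expfzDr // -exprnP -mulmxXSr addrC addrA addrC; congr (_ + _).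
by rewrite -scalerDl mulrDr addrC.
Qed.

End Chains.

(** * Exactness of the cone over a hyperplane *)

Section Exactness.
Variables (F : fieldType) (K : finFieldType) (n : nat).
Local Notation L := {vspace 'rV[K]_n}.
Local Notation N := #|{: L}|.
Local Notation q := (#|{: K}|%:R : F).
Local Notation "[ i ]_q" := (qint F #|{: K}| i).
Local Notation bd := (bd F K n).
Local Notation bvec := (@bvec F K n).
Local Notation chains := (@chains F K n).
Local Notation hlift := (@hlift F K n).
Implicit Types (A B H S T U V W : L) (k : int).
Hypothesis q_neq0 : q != 0.

(** It kills the chains of W and inverts [hlift] up to a power of q, which shows that the sum of the
    chains of W and their lifts is direct. *)
Definition restr W V : 'M[F]_N := mx_of_basis (fun U =>
  if (U <= V)%VS && ~~ (U <= W)%VS then bvec (U :&: W)%VS else 0).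

Lemma restrE W V U : bvec U *m restr W V =
  if (U <= V)%VS && ~~ (U <= W)%VS then bvec (U :&: W)%VS else 0.
Proof. exact: mul_bvec. Qed.

Lemma chains_restr W V k r (x : 'M[F]_(r, N)) :
  (x <= chains W k)%MS -> x *m restr W V = 0.
Proof.
move=> xW; rewrite -(mulmx0 _ x); apply: chains_ext xW _ => U sUW _.
by rewrite restrE sUW andbF mulmx0.
Qed.

Lemma lift_restr W V k r (x : 'M[F]_(r, N)) : hyper W V -> (x <= chains W k)%MS ->
  x *m hlift W V *m restr W V = q ^ ((\dim W)%:Z - k) *: x.
Proof.
move=> hW xW; rewrite -mulmxA -[in RHS](mulmx1 x) scalemxAr.
apply: chains_ext xW _ => A sAW dA.
rewrite mulmxA liftE mulmx_suml -scalemxAr mulmx1 -(qexpzE F sAW dA).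
under eq_bigr => U /and3P[sUV nU /eqP cU] do rewrite restrE sUV nU cU /=.
rewrite sumr_const -scaler_nat -natrX; congr (_%:R *: _).
by rewrite -(card_compl hW sAW); apply: eq_card => U; rewrite inE.
Qed.

Lemma lift_sub_chains W V k l r (x : 'M[F]_(r, N)) : hyper W V ->
  (x <= chains W k)%MS -> (x *m hlift W V <= chains W l)%MS -> x = 0.
Proof.
move=> hW xW /(chains_restr V); rewrite (lift_restr hW xW) => /eqP.
by rewrite scaler_eq0 (negPf (expfz_neq0 _ q_neq0)) => /eqP.
Qed.

Lemma bvec_hyper_lift W V : hyper W V -> bvec W *m hlift W V = bvec V.
Proof.
move=> hW; rewrite liftE (big_pred1 V) // => U.
apply/and3P/eqP=> [[sUV nU /eqP cU]|->].
  apply/eqP; rewrite eqEdim sUV (hyper_dim hW).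
  by rewrite (hyper_dim (nsub_hyper_cap hW sUV nU cU)) leqnn.
by rewrite subvv hyper_nsub // (capv_idPr (hyperS hW)) eqxx.
Qed.

Variable m : nat.
Hypotheses (m_gt1 : (1 < m)%N) (qint_m : [m]_q = 0).
Hypothesis qint_neq0 : forall i, (0 < i < m)%N -> [i]_q != 0.

(** Induction on dimension: V is itself the lift of its hyperplane W, and the error term of
    [lift_bdX] carries the factor [[m]_q], which is 0. *)
Lemma bdX_eq0 : bd ^+ m = 0.
Proof.
apply: eq_mx_bvec => V; rewrite mulmx0.
have [d] := ubnP (\dim V); elim: d V => // d IHd V ltd.
have [V0|V0] := eqVneq V 0%VS.
  rewrite -(ltn_predK m_gt1) mulmxXS bdE big_pred0 ?mul0mx // => A.
  by apply/negP=> /hyper_dim; rewrite V0 dimv0.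
have neV0 : 0%VS != V by rewrite eq_sym.
have [W _ hW] := exists_hyper (sub0v V) neV0.
rewrite -(bvec_hyper_lift hW) (lift_bdX q_neq0 m hW (bvec_chains F (subvv W) erefl)).
by rewrite qint_m mulr0 scale0r addr0 IHd ?mul0mx // -ltnS -(hyper_dim hW).
Qed.

Lemma qint_add i j : (i + j = m)%N -> [j]_q = - (q ^+ j * [i]_q).
Proof.
move=> ij; apply/eqP; rewrite -addr_eq0 -qint_m -ij addnC /qint big_split_ord /=.
by rewrite mulr_sumr; under [in X in _ + X]eq_bigr do rewrite -exprD.
Qed.

(** With j = m - i, the disjunction is the negation of the two inequalities of a middle index for
    the dimension of V. Allowing x to have several rows lets a whole module of cycles be treated at
    once. *)
Definition exact_on V := forall k i j r (x : 'M[F]_(r, N)),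
    (0 < i)%N -> (0 < j)%N -> (i + j = m)%N ->
    (2 * k + j%:Z <= (\dim V)%:Z) || ((\dim V)%:Z <= 2 * k - i%:Z) ->
    (x <= chains V k)%MS -> x *m bd ^+ i = 0 ->
  exists2 y, (y <= chains V (k + j%:Z))%MS & x = y *m bd ^+ j.

Lemma bdX_chainsE V k l j r (x : 'M[F]_(r, N)) : l = k - j%:Z ->
  (x <= chains V k)%MS -> (x *m bd ^+ j <= chains V l)%MS.
Proof. by move->; apply: bdX_chains. Qed.

Lemma lift_chainsE W V k l r (x : 'M[F]_(r, N)) : hyper W V -> l = k + 1 ->
  (x <= chains W k)%MS -> (x *m hlift W V <= chains V l)%MS.
Proof. by move=> hW ->; apply: lift_chains. Qed.

(* The degenerate cases are i = 0, where x = 0, and j = 0, where y = x. *)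
Lemma exact_onW V k i j r (x : 'M[F]_(r, N)) : exact_on V -> (i + j = m)%N ->
    (2 * k + j%:Z <= (\dim V)%:Z) || ((\dim V)%:Z <= 2 * k - i%:Z) ->
    (x <= chains V k)%MS -> x *m bd ^+ i = 0 ->
  exists2 y, (y <= chains V (k + j%:Z))%MS & x = y *m bd ^+ j.
Proof.
move=> exV; case: i => [_ _ _|i].
  by rewrite expr0 mulmx1 => ->; exists 0; rewrite ?sub0mx ?mul0mx.
case: j => [_ _ xV _|j]; last exact: exV.
by exists x; rewrite ?addr0 ?expr0 ?mulmx1.
Qed.

Section Cone.
Variables (W V : L).
Hypotheses (hW : hyper W V) (exW : exact_on W).
Variables (k : int) (i j r : nat).
Hypotheses (i_gt0 : (0 < i)%N) (j_gt0 : (0 < j)%N) (ij : (i + j = m)%N).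
Let ij1 : (i.-1 + j.+1 = m)%N. Proof. by clear -ij i_gt0; lia. Qed.
Let ij2 : (i.+1 + j.-1 = m)%N. Proof. by clear -ij j_gt0; lia. Qed.
Let e1 : k - 1 + j.+1%:Z = k + j%:Z. Proof. by clear; lia. Qed.
Let e2 : k = k + j%:Z - j%:Z. Proof. by clear; lia. Qed.
Let e3 : k + j%:Z = k + j.-1%:Z + 1. Proof. by clear -j_gt0; lia. Qed.
Let e4 : k = (k - 1 + j%:Z) - j.-1%:Z. Proof. by clear -j_gt0; lia. Qed.
Let e5 : k + j%:Z = k - 1 + j%:Z + 1. Proof. by clear; lia. Qed.
Let e6 : k - i%:Z = k - 1 - i.-1%:Z. Proof. by clear -i_gt0; lia. Qed.
Let qi0 : [i]_q != 0. Proof. by apply: qint_neq0; lia. Qed.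
Let qj0 : [j]_q != 0. Proof. by apply: qint_neq0; lia. Qed.
Let qz0 l : q ^ l != 0. Proof. exact: expfz_neq0. Qed.

(** The index is non-middle for V but may be middle for W. This happens only when 2k + j = dim W +
    1, and then the neighbouring indices (k - 1, i - 1) and (k, i + 1) are non-middle for W;
    exactness is applied at both. *)
Lemma base_exact (a : 'M[F]_(r, N)) : (a <= chains W k)%MS ->
    (2 * k + j%:Z <= (\dim V)%:Z) || ((\dim V)%:Z <= 2 * k - i%:Z) ->
    a *m bd ^+ i = 0 ->
  exists2 z, (z <= chains V (k + j%:Z))%MS & a = z *m bd ^+ j.
Proof.
have dV := hyper_dim hW => aW cond ai0.
have [cond'|edge] := boolP ((2 * k + j%:Z <= (\dim W)%:Z)
                            || ((\dim W)%:Z <= 2 * k - i%:Z)).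
  have [z zW ->] := exW i_gt0 j_gt0 ij cond' aW ai0.
  by exists z => //; apply: submx_trans zW (chainsS _ _ (hyperS hW)).
have eqn : 2 * k + j%:Z = (\dim W)%:Z + 1.
  by clear -cond edge dV; lia.
have cond1 : (2 * (k - 1) + j.+1%:Z <= (\dim W)%:Z)
          || ((\dim W)%:Z <= 2 * (k - 1) - i.-1%:Z).
  by clear -eqn i_gt0; lia.
have abdi : a *m bd *m bd ^+ i.-1 = 0 by rewrite -mulmxXS prednK.
have [b bW bE] := exact_onW exW ij1 cond1 (bd_chains aW) abdi.
(* Since [bE] gives a bd = b bd^(j+1), the difference is killed by a single [bd]. *)
pose a1 := a - b *m bd ^+ j.
have bW' : (b <= chains W (k + j%:Z))%MS by rewrite -e1.
have a1W : (a1 <= chains W k)%MS.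
  by rewrite addmx_sub // -scaleN1r scalemx_sub // (bdX_chainsE e2 bW').
have a1bd : a1 *m bd = 0 by rewrite mulmxBl -mulmxXSr bE subrr.
have a1i : a1 *m bd ^+ i.+1 = 0 by rewrite mulmxXS a1bd mul0mx.
have cond' : (2 * k + j.-1%:Z <= (\dim W)%:Z) || ((\dim W)%:Z <= 2 * k - i.+1%:Z).
  by clear -eqn i_gt0 j_gt0; lia.
have [z zW zE] := exact_onW exW ij2 cond' a1W a1i.
have zbd : z *m bd ^+ j = 0 by rewrite -(prednK j_gt0) mulmxXSr -zE.
pose c := q ^ ((\dim W)%:Z - (k + j.-1%:Z)) * [j]_q.
have c0 : c != 0 by rewrite mulf_neq0.
(* As z bd^j = 0, the boundary of the lift of z reduces to its error term c z bd^(j-1) = c a1. *)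
exists (b + c^-1 *: (z *m hlift W V)).
  rewrite addmx_sub ?scalemx_sub // ?(submx_trans bW' (chainsS _ _ (hyperS hW))) //.
  exact: lift_chainsE hW e3 zW.
rewrite mulmxDl -scalemxAl (lift_bdX q_neq0 j hW zW) zbd mul0mx add0r -zE.
by rewrite scalerA mulVf // scale1r /a1 addrC subrK.
Qed.

Variables a y : 'M[F]_(r, N).
Hypotheses (aW : (a <= chains W k)%MS) (yW : (y <= chains W (k - 1))%MS).

(** Modulo chains of W the boundary is the lift of y bd^i, which must vanish because lifts meet the
    chains of W trivially; the chain part in W must then vanish too. *)
Lemma cone_cycle : (a + y *m hlift W V) *m bd ^+ i = 0 ->
  y *m bd ^+ i = 0 /\
  a *m bd ^+ i + (q ^ ((\dim W)%:Z - (k - 1)) * [i]_q) *: (y *m bd ^+ i.-1) = 0.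
Proof.
rewrite mulmxDl (lift_bdX q_neq0 i hW yW) addrCA => E.
suff yi0 : y *m bd ^+ i = 0 by move: E; rewrite yi0 mul0mx add0r.
have yiW := bdX_chains i yW.
apply: (@lift_sub_chains W V _ (k - i%:Z) _ _ hW yiW).
move/eqP: E; rewrite addr_eq0 => /eqP ->.
rewrite -scaleN1r scalemx_sub // addmx_sub ?bdX_chains // scalemx_sub //.
exact: bdX_chainsE e6 yW.
Qed.

(** If (k - 1, i) is non-middle for W, then y is a boundary there, and subtracting the boundary of a
    lift leaves a cycle of W for [base_exact]. Otherwise 2k - i = dim W + 1, the dual edge case,
    again handled through the two neighbouring indices. *)
Lemma cone_exact : (2 * k + j%:Z <= (\dim V)%:Z) || ((\dim V)%:Z <= 2 * k - i%:Z) ->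
    (a + y *m hlift W V) *m bd ^+ i = 0 ->
  exists2 z, (z <= chains V (k + j%:Z))%MS & a + y *m hlift W V = z *m bd ^+ j.
Proof.
have dV := hyper_dim hW => cond xi0; have [yi0 ayE] := cone_cycle xi0.
have sub z l : (z <= chains W l)%MS -> (z <= chains V l)%MS.
  by move/submx_trans; apply; apply: chainsS (hyperS hW).
have [cond'|edge] := boolP ((2 * (k - 1) + j%:Z <= (\dim W)%:Z)
                            || ((\dim W)%:Z <= 2 * (k - 1) - i%:Z)).
  have [z zW yE] := exW i_gt0 j_gt0 ij cond' yW yi0.
  pose c := q ^ ((\dim W)%:Z - (k - 1 + j%:Z)) * [j]_q.
  have liftzE : z *m hlift W V *m bd ^+ j = y *m hlift W V + c *: (z *m bd ^+ j.-1).
    by rewrite (lift_bdX q_neq0 j hW zW) -yE.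
  pose a' := a - c *: (z *m bd ^+ j.-1).
  have xE : a + y *m hlift W V = a' + z *m hlift W V *m bd ^+ j.
    by rewrite liftzE [_ + c *: _]addrC addrA subrK.
  have a'i0 : a' *m bd ^+ i = 0.
    move: xi0; rewrite xE mulmxDl -mulmxXD addnC ij bdX_eq0 mulmx0 addr0; exact.
  have a'W : (a' <= chains W k)%MS.
    rewrite addmx_sub // -scaleN1r !scalemx_sub //.
    exact: bdX_chainsE e4 zW.
  have [z' z'V a'E] := base_exact a'W cond a'i0.
  exists (z' + z *m hlift W V); last by rewrite mulmxDl xE a'E.
  by rewrite addmx_sub // (lift_chainsE hW e5 zW).
have eqn : 2 * k - i%:Z = (\dim W)%:Z + 1.
  by clear -cond edge dV; lia.
pose c := q ^ ((\dim W)%:Z - (k - 1)) * [i]_q.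
have c0 : c != 0 by rewrite mulf_neq0.
have cond1 : (2 * (k - 1) + j.+1%:Z <= (\dim W)%:Z)
          || ((\dim W)%:Z <= 2 * (k - 1) - i.-1%:Z).
  by clear -eqn i_gt0; lia.
(* The second relation of [cone_cycle], divided by c, says that this combination is killed by
   bd^(i-1). *)
have yaW : ((y + c^-1 *: (a *m bd))%R <= chains W (k - 1))%MS.
  by rewrite addmx_sub // scalemx_sub // bd_chains.
have yai : (y + c^-1 *: (a *m bd)) *m bd ^+ i.-1 = 0.
  rewrite mulmxDl -scalemxAl -mulmxXS prednK //.
  by rewrite -[y *m _](scalerK c0) -scalerDr [_ + a *m _]addrC ayE scaler0.
have [z zW zE] := exact_onW exW ij1 cond1 yaW yai.
pose a' := a - c *: (z *m bd ^+ j).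
have yE : y = - c^-1 *: (a' *m bd).
  rewrite mulmxBl -scalemxAl -mulmxXSr -zE scalerBr !scalerA mulNr mulVf //.
  by rewrite scaleNr scaleN1r opprK addrC addrK.
have zW' : (z <= chains W (k + j%:Z))%MS.
  by rewrite -e1.
have a'W : (a' <= chains W k)%MS.
  rewrite addmx_sub // -scaleN1r !scalemx_sub //.
  exact: bdX_chainsE e2 zW'.
have a'i1 : a' *m bd ^+ i.+1 = 0.
  move/eqP: yi0; rewrite yE -scalemxAl -mulmxXS scaler_eq0 oppr_eq0 invr_eq0.
  by rewrite (negPf c0) => /eqP.
have cond' : (2 * k + j.-1%:Z <= (\dim W)%:Z) || ((\dim W)%:Z <= 2 * k - i.+1%:Z).
  by clear -eqn i_gt0 j_gt0; lia.
have [u uW uE] := exact_onW exW ij2 cond' a'W a'i1.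
have ujE : u *m bd ^+ j = a' *m bd by rewrite -(prednK j_gt0) mulmxXSr -uE.
(* The error term of the lift of u has coefficient -c, because [[i + j]_q] = 0 relates [[j]_q] to
   [[i]_q]. This is what restores a' in the final computation. *)
have cE : q ^ ((\dim W)%:Z - (k + j.-1%:Z)) * [j]_q = - c.
  rewrite (qint_add ij) mulrN mulrA /c exprnP -expfzDr //; congr (- (q ^ _ * _)).
  by clear -j_gt0; lia.
exists (c *: z - c^-1 *: (u *m hlift W V)).
  apply: addmx_sub; first exact/scalemx_sub/sub.
  rewrite -scaleN1r !scalemx_sub //.
  exact: lift_chainsE hW e3 uW.
rewrite mulmxBl -!scalemxAl (lift_bdX q_neq0 j hW uW) ujE -uE cE.
rewrite scalerDr scalerA mulrN mulVf // scaleN1r opprB addrA [c *: _ + _]addrC.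
by rewrite subrK yE -scalemxAl scaleNr.
Qed.
End Cone.

End Exactness.

(** * The pieces attached to the other hyperplanes *)

Section Twist.
Variables (F : fieldType) (K : finFieldType) (n : nat).
Local Notation L := {vspace 'rV[K]_n}.
Local Notation N := #|{: L}|.
Local Notation q := (#|{: K}|%:R : F).
Local Notation "[ i ]_q" := (qint F #|{: K}| i).
Local Notation bd := (bd F K n).
Local Notation bvec := (@bvec F K n).
Local Notation chains := (@chains F K n).
Local Notation hlift := (@hlift F K n).
Implicit Types (A B H S T U V W : L) (k : int).
Hypothesis q_neq0 : q != 0.

(* [twist] is the transpose of [untwist]: on the subspaces U of V with fixed
   U :&: W, an affine space, both are weighted by the characteristic function
   of [B] minus its mean [q^-1]. *)
Definition wt B U : F := (U <= B)%VS%:R - q^-1.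

Definition twist B W V : 'M[F]_N := mx_of_basis (fun U =>
  if [&& (U <= V)%VS, ~~ (U <= W)%VS & (U :&: W <= B)%VS]
  then wt B U *: bvec (U :&: W)%VS else 0).

Definition untwist B W V : 'M[F]_N := hlift (B :&: W)%VS B - q^-1 *: hlift W V.

Lemma twistE B W V U : bvec U *m twist B W V =
  if [&& (U <= V)%VS, ~~ (U <= W)%VS & (U :&: W <= B)%VS]
  then wt B U *: bvec (U :&: W)%VS else 0.
Proof. exact: mul_bvec. Qed.

Section Pair.
Variables (B W V : L).
Hypotheses (hW : hyper W V) (hB : hyper B V) (neBW : B != W).

Lemma hyper_pair : hyper (B :&: W) B /\ hyper (B :&: W) W.
Proof.
split; first exact: hyper_cap hW (hyperS hB) (hyper_nsub_neq hB hW neBW).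
by rewrite capvC (hyper_cap hB (hyperS hW)) // (hyper_nsub_neq hW hB) // eq_sym.
Qed.

Lemma untwist_chains k r (x : 'M[F]_(r, N)) :
  (x <= chains (B :&: W) k)%MS -> (x *m untwist B W V <= chains V (k + 1))%MS.
Proof.
move=> xH; have [hHB hHW] := hyper_pair.
rewrite mulmxBr addmx_sub //.
  exact: submx_trans (lift_chains hHB xH) (chainsS _ _ (hyperS hB)).
rewrite -scalemxAr -scaleN1r !scalemx_sub // lift_chains //.
exact: submx_trans xH (chainsS _ _ (hyperS hHW)).
Qed.

(** The error terms of the two lifts cancel: W has one dimension more than B :&: W, and the
    resulting extra factor q is absorbed by the coefficient q^-1. *)
Lemma untwist_bd k r (x : 'M[F]_(r, N)) : (x <= chains (B :&: W) k)%MS ->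
  x *m untwist B W V *m bd = x *m bd *m untwist B W V.
Proof.
move=> xH; have [hHB hHW] := hyper_pair.
have xW := submx_trans xH (chainsS F k (hyperS hHW)).
rewrite !mulmxBr mulmxBl -!scalemxAr -scalemxAl.
rewrite (lift_bd hHB xH) (lift_bd hW xW).
rewrite scalerDr scalerA (hyper_dim hHW).
have -> : (\dim (B :&: W)).+1%:Z - k = 1%:Z + ((\dim (B :&: W))%:Z - k).
  by clear; lia.
by rewrite [q ^ (1%:Z + _)]expfzDr // expr1z mulKf // opprD addrACA subrr add0r.
Qed.

Lemma untwist_bdX k r (x : 'M[F]_(r, N)) j : (x <= chains (B :&: W) k)%MS ->
  x *m untwist B W V *m bd ^+ j = x *m bd ^+ j *m untwist B W V.
Proof.
move=> xH; elim: j => [|j IHj]; first by rewrite expr0 !mulmx1.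
by rewrite mulmxXSr IHj (untwist_bd (bdX_chains j xH)) -mulmxXSr.
Qed.

Lemma twist_chains k r (x : 'M[F]_(r, N)) :
  (x <= chains V k)%MS -> (x *m twist B W V <= chains (B :&: W) (k - 1))%MS.
Proof.
move=> xV; apply: submx_trans (submxMr _ xV) _; apply: chainsM_sub => U sUV dU.
rewrite twistE; case: ifP => [/and3P[_ nU sUB]|_]; last exact: sub0mx.
rewrite scalemx_sub // bvec_chains // ?subv_cap ?sUB ?capvSr //.
by have := hyper_dim (hyper_cap hW sUV nU); clear -dU; lia.
Qed.

(** There are q subspaces U' in the sum. If U lies in B, or if A does but U does not, the weight is
    constant and equal to that of U. If A is not in B, only U' = U :&: B lies in B, and the sum is 1
    - q q^-1 = 0. *)
Lemma sum_wt A' A U : hyper A' A -> hyper A U -> (U <= V)%VS -> (A' <= B)%VS ->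
  \sum_(U' : L | [&& (U' <= U)%VS, ~~ (U' <= A)%VS & (U' :&: A)%VS == A']) wt B U'
    = if (A <= B)%VS then q * wt B U else 0.
Proof.
move=> hA hU sUV sA'B.
pose P U' := [&& (U' <= U)%VS, ~~ (U' <= A)%VS & (U' :&: A)%VS == A'].
rewrite -[LHS]/(\sum_(U' | P U') wt B U').
have cP : #|P| = #|K|.
  have qE : (#|K| ^ (\dim A - \dim A'))%N = #|K|.
    by rewrite (hyper_dim hA) subSnn expn1.
  rewrite -[RHS]qE -(card_compl hU (hyperS hA)).
  by apply: eq_card => U'; rewrite [in RHS]inE.
have constP c : (forall U', P U' -> wt B U' = c) -> \sum_(U' | P U') wt B U' = q * c.
  by move=> cE; rewrite (eq_bigr _ cE) sumr_const cP mulr_natl.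
have [sUB|nUB] := boolP (U <= B)%VS.
  rewrite (subv_trans (hyperS hU) sUB); apply: constP => U' /and3P[sU' _ _].
  by rewrite /wt sUB (subv_trans sU' sUB).
have hUB := hyper_cap hB sUV nUB.
have [sAB|nAB] := boolP (A <= B)%VS.
  apply: constP => U' /and3P[sU' nU' _]; rewrite /wt (negPf nUB).
  suff -> : (U' <= B)%VS = false by [].
  apply: contraNF nU' => sU'B.
  have -> : A = (U :&: B)%VS by apply: (hyper_eq hU hUB); rewrite subv_cap (hyperS hU).
  by rewrite subv_cap sU'.
have sA'U : (A' <= U)%VS by exact: subv_trans (hyperS hA) (hyperS hU).
have neq : (U :&: B)%VS != A.
  by apply: contraNneq nAB => <-; exact: capvSr.
have nUBA := hyper_nsub_neq hUB hU neq.
have cA' : (U :&: B :&: A)%VS = A'.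
  apply/esym/(hyper_eq hA); first by rewrite capvC (hyper_cap hUB (hyperS hU)) //
    (hyper_nsub_neq hU hUB) // eq_sym.
  by rewrite !subv_cap sA'U sA'B (hyperS hA).
have wtE U' : P U' -> wt B U' = (U' == (U :&: B)%VS)%:R - q^-1.
  case/and3P=> sU' nU' /eqP cU'; congr (_%:R - _); congr (nat_of_bool _).
  apply/idP/eqP=> [sU'B|->]; last exact: capvSr.
  have hU' : hyper U' U.
    rewrite /hyper sU' (hyper_dim hU) (hyper_dim hA).
    by rewrite (hyper_dim (nsub_hyper_cap hU sU' nU' cU')) /=.
  by apply: (hyper_eq hU' hUB); rewrite subv_cap sU'.
rewrite (eq_bigr _ wtE) sumrB sumr_const cP -[_ *+ _]mulr_natl divff //.
have PUB : P (U :&: B)%VS by rewrite /P capvSl nUBA cA' eqxx.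
rewrite (bigD1 _ PUB) /= eqxx big1 ?addr0 ?subrr // => U' /andP[_ /negPf->].
by [].
Qed.

(** Only hyperplanes U' of U outside W with U' :&: W in B contribute. Grouping them by A' = U' :&: W
    makes the coefficient of A' the sum evaluated in [sum_wt]. *)
Lemma bvec_twist_bd U : (U <= V)%VS ->
  bvec U *m bd *m twist B W V = q *: (bvec U *m twist B W V *m bd).
Proof.
move=> sUV; rewrite bdE mulmx_suml.
have [sUW|nU] := boolP (U <= W)%VS.
  rewrite twistE sUW andbF mul0mx scaler0 big1 // => A hA.
  by rewrite twistE (subv_trans (hyperS hA) sUW) andbF.
have hA := hyper_cap hW sUV nU; set A := (U :&: W)%VS in hA *.
have capE U' : (U' <= U)%VS -> (U' :&: A)%VS = (U' :&: W)%VS.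
  by move=> sU'; rewrite /A capvA (capv_idPl sU').
have subE U' : (U' <= U)%VS -> (U' <= A)%VS = (U' <= W)%VS.
  by move=> sU'; rewrite subv_cap sU'.
transitivity (\sum_(A' | hyper A' A && (A' <= B)%VS)
   (\sum_(U' : L | [&& (U' <= U)%VS, ~~ (U' <= A)%VS & (U' :&: A)%VS == A'])
      wt B U') *: bvec A'); last first.
  rewrite twistE sUV nU -/A /=.
  under eq_bigr => A' /andP[hA' sA'] do rewrite (sum_wt hA' hA sUV sA').
  case: (boolP (A <= B)%VS) => [sAB|nAB]; last first.
    by rewrite mul0mx scaler0 big1 // => A' _; rewrite scale0r.
  rewrite -scalemxAl scalerA bdE scaler_sumr; apply: eq_bigl => A'.
  by apply: andb_idr => /hyperS/subv_trans; apply.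
under [RHS]eq_bigr do rewrite scaler_suml.
rewrite (bigID (fun U' => ~~ (U' <= W)%VS && (U' :&: W <= B)%VS)) /= addrC.
rewrite big1 ?add0r => [|U' /andP[hU' /negPf nU']]; last by rewrite twistE nU' andbF.
rewrite (partition_big (fun U' => U' :&: W)%VS
          (fun A' => hyper A' A && (A' <= B)%VS)) /=; last first.
  move=> U' /and3P[hU' nU' ->]; rewrite andbT.
  by have [] := hyper_cap_pair hW sUV hU' nU'.
apply: eq_bigr => A' /andP[hA' sA'B]; apply: eq_big => [U'|U'].
  apply/idP/idP.
    case/andP=> /and3P[hU' nU' _] /eqP cU'.
    by rewrite (hyperS hU') subE ?capE ?(hyperS hU') // nU' cU' eqxx.
  case/and3P=> sU' nU' /eqP cU'.
  rewrite -capE // cU' sA'B eqxx -subE // nU' /hyper sU' /= andbT.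
  rewrite (hyper_dim hA) (hyper_dim hA').
  by rewrite (hyper_dim (nsub_hyper_cap hA sU' nU' cU')) eqxx.
case/andP=> /and3P[hU' nU' sU'B] /eqP cU'.
by rewrite twistE (subv_trans (hyperS hU') sUV) nU' sU'B cU'.
Qed.

Lemma twist_bdX k r (x : 'M[F]_(r, N)) j : (x <= chains V k)%MS ->
  x *m bd ^+ j *m twist B W V = q ^+ j *: (x *m twist B W V *m bd ^+ j).
Proof.
move=> xV; elim: j => [|j IHj]; first by rewrite !expr0 !mulmx1 scale1r.
have xjV := bdX_chains j xV.
have E : x *m bd ^+ j *m bd *m twist B W V =
    q *: (x *m bd ^+ j *m twist B W V *m bd).
  move: (x *m bd ^+ j) xjV => z zV; rewrite -!mulmxA scalemxAr.
  apply: chains_ext zV _ => U sUV _.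
  by rewrite mulmxA bvec_twist_bd // -!mulmxA -scalemxAr.
by rewrite mulmxXSr E IHj -scalemxAl scalerA -exprS -mulmxXSr.
Qed.

Lemma bvec_untwist A : (A <= B)%VS -> (A <= W)%VS ->
  bvec A *m untwist B W V =
    \sum_(U : L | [&& (U <= V)%VS, ~~ (U <= W)%VS & (U :&: W)%VS == A])
       wt B U *: bvec U.
Proof.
move=> sAB sAW; rewrite mulmxBr -scalemxAr !liftE.
under [RHS]eq_bigr do rewrite scalerBl.
rewrite sumrB -scaler_sumr; congr (_ - _).
rewrite [RHS](bigID (fun U => (U <= B)%VS)) /= [X in _ = _ + X]big1 ?addr0; last first.
  by move=> U /andP[_ /negPf ->]; rewrite scale0r.
apply: eq_big => [U|U /andP[sUB _]]; last first.
  by rewrite sUB scale1r.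
have [sUB|nUB] := boolP (U <= B)%VS; last by rewrite andbF.
by rewrite andbT (subv_trans sUB (hyperS hB)) subv_cap sUB capvA (capv_idPl sUB).
Qed.

End Pair.
End Twist.

(** * Vanishing outside the middle *)

Section Inversion.
Variables (F : fieldType) (K : finFieldType) (n : nat).
Local Notation L := {vspace 'rV[K]_n}.
Local Notation N := #|{: L}|.
Local Notation q := (#|{: K}|%:R : F).
Local Notation "[ i ]_q" := (qint F #|{: K}| i).
Local Notation bd := (bd F K n).
Local Notation bvec := (@bvec F K n).
Local Notation chains := (@chains F K n).
Local Notation hlift := (@hlift F K n).
Local Notation wt := (@wt F K n).
Local Notation twist := (@twist F K n).
Local Notation untwist := (@untwist F K n).
Implicit Types (A B H S T U V W : L) (k : int).
Hypothesis q_neq0 : q != 0.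

Section Pair.
Variables (W V : L).
Hypothesis hW : hyper W V.

(** A hyperplane B containing U contains U' exactly when it contains U + U', so [card_hyper]
    applies. Containing U already forces B != W and U :&: W <= B. *)
Lemma sum_hyper U U' : (U <= V)%VS -> (U' <= V)%VS -> ~~ (U <= W)%VS ->
    (U :&: W)%VS = (U' :&: W)%VS -> hyper U (U + U') ->
  \sum_(B | [&& hyper B V, B != W & (U :&: W <= B)%VS])
     ((U <= B)%VS && ~~ (U' <= B)%VS)%:R = q ^+ (\dim V - (\dim U).+1) :> F.
Proof.
move=> sUV sU'V nU cUU' hU; rewrite -natr_sum -natrX; congr _%:R.
have sSV : (U + U' <= V)%VS by rewrite subv_add sUV.
rewrite -(hyper_dim hU) -(card_hyper hU sSV) -sum1_card big_mkcond [RHS]big_mkcond /=.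
apply: eq_bigr => B _; rewrite inE subv_add.
have [hB|] := boolP (hyper B V) => //=.
have [sUB|] := boolP (U <= B)%VS; last by rewrite if_same.
rewrite (subv_trans (capvSl U W) sUB) /=.
have -> : B != W by apply: contraNneq nU => <-.
by case: ifP.
Qed.

(** Both have U :&: W as a hyperplane, so, being distinct, they meet in exactly that subspace. *)
Lemma hyper_addv U U' : (U <= V)%VS -> (U' <= V)%VS -> ~~ (U <= W)%VS ->
    ~~ (U' <= W)%VS -> (U :&: W)%VS = (U' :&: W)%VS -> U != U' ->
  hyper U (U + U').
Proof.
move=> sUV sU'V nU nU' cUU' neU.
have dU := hyper_dim (hyper_cap hW sUV nU).
have dU' := hyper_dim (hyper_cap hW sU'V nU'); rewrite -cUU' in dU'.
rewrite /hyper addvSl /=.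
suff dc : \dim (U :&: U') = \dim (U :&: W).
  by have := dimv_sum_cap U U'; clear -dU dU' dc; lia.
apply/eqP; rewrite eqn_leq (dimvS (_ : U :&: W <= U :&: U')%VS) ?andbT; last first.
  by rewrite subv_cap capvSl cUU' capvSl.
rewrite -ltnS -dU ltn_neqAle (dimvS (capvSl _ _)) andbT.
rewrite (dimv_leqif_eq (capvSl U U')); apply: contra neU => /eqP cE.
by rewrite eqEdim dU dU' leqnn andbT -cE capvSr.
Qed.

(* Radon inversion: the U <= V with U :&: W = A form an affine space, whose
   hyperplanes are cut out by the B >= A; a point mass is recovered, up to a
   constant function, from its sums over them. *)
Lemma sum_twist_untwist U : (U <= V)%VS -> ~~ (U <= W)%VS -> exists c,
  \sum_(B | hyper B V && (B != W)) bvec U *m twist B W V *m untwist B W V =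
    q ^ ((\dim V)%:Z - (\dim U)%:Z - 1) *: bvec U + c *: (bvec (U :&: W)%VS *m hlift W V).
Proof.
move=> sUV nU; set A := (U :&: W)%VS; set b := q ^ _.
pose c U' := \sum_(B | [&& hyper B V, B != W & (A <= B)%VS]) wt B U * wt B U'.
pose X U' := [&& (U' <= V)%VS, ~~ (U' <= W)%VS & (U' :&: W)%VS == A].
have XU : X U by rewrite /X sUV nU eqxx.
(* Here c U' is the coefficient of U' in the double sum; it takes the same value at all U' other
   than U, which gives a point mass plus a multiple of the lift. *)
have cE U' : X U' -> U' != U -> c U' = c U - b.
  case/and3P=> sU'V nU' /eqP cU' neU.
  apply/eqP; rewrite eq_sym subr_eq addrC -subr_eq -sumrB; apply/eqP.
  (* The last two terms have equal sums, by [sum_hyper] with U and U' exchanged, so they cancel and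
     b remains. *)
  rewrite (eq_bigr (fun B => ((U <= B)%VS && ~~ (U' <= B)%VS)%:R
      - q^-1 * ((U <= B)%VS && ~~ (U' <= B)%VS)%:R
      + q^-1 * ((U' <= B)%VS && ~~ (U <= B)%VS)%:R)) => [|B _]; last first.
    rewrite /wt; do 2!case: (_ <= B)%VS => /=; ring.
  have hU : hyper U (U + U') by rewrite hyper_addv // eq_sym.
  rewrite big_split sumrB /= -!mulr_sumr sum_hyper //.
  have bE : q ^+ (\dim V - (\dim U).+1) = b.
    rewrite exprnP; congr (q ^ _); have := hyper_dim hU.
    have : (U + U' <= V)%VS by rewrite subv_add sUV.
    by move/dimvS; clear; lia.
  have dUU' : \dim U' = \dim U.
    rewrite (hyper_dim (hyper_cap hW sUV nU)).
    by rewrite (hyper_dim (hyper_cap hW sU'V nU')) cU'.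
  have hU' : hyper U' (U' + U) by rewrite hyper_addv.
  by have := sum_hyper sU'V sUV nU' cU' hU'; rewrite cU' dUU' => ->; rewrite bE subrK.
exists (c U - b); rewrite liftE -/(X _) scaler_sumr.
rewrite [in RHS](bigD1 _ XU) /= addrA -scalerDl [b + _]addrC subrK.
transitivity (\sum_(U' | X U') c U' *: bvec U'); last first.
  rewrite (bigD1 _ XU) /=; congr (_ + _); apply: eq_bigr => U' /andP[XU' neU].
  by rewrite cE.
under [RHS]eq_bigr do rewrite scaler_suml.
rewrite exchange_big /= [LHS](bigID (fun B => (A <= B)%VS)) /= addrC.
rewrite big1 ?add0r => [|B /andP[_ /negPf nAB]]; last first.
  by rewrite twistE nAB !andbF mul0mx.
apply: eq_big => [B|B]; first by rewrite andbA.
case/andP=> /andP[hB neB] sAB; rewrite twistE sUV nU sAB /= -scalemxAl.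
rewrite bvec_untwist // ?capvSr // scaler_sumr.
by apply: eq_bigr => U' _; rewrite scalerA.
Qed.

Definition twist_sum : 'M[F]_N :=
  \sum_(B | hyper B V && (B != W)) twist B W V *m untwist B W V.

(** This splits x into a part coming from the other hyperplanes and a part in the cone over W. The
    scalar normalises the point mass of [sum_twist_untwist], and its constant-function term is a
    lift. *)
Lemma twist_sum_chains k r (x : 'M[F]_(r, N)) : (x <= chains V k)%MS ->
  (x - (q ^ ((\dim V)%:Z - k - 1))^-1 *: (x *m twist_sum)
     <= chains W k + chains W (k - 1) *m hlift W V)%MS.
Proof.
move=> xV; set c := _^-1.
have -> : x - c *: (x *m twist_sum) = x *m (1%:M - c *: twist_sum).
  by rewrite mulmxBr mulmx1 -scalemxAr.
rewrite {}/c.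
apply: submx_trans (submxMr _ xV) _; apply: chainsM_sub => U sUV dU.
rewrite mulmxBr mulmx1 -scalemxAr mulmx_sumr.
have [sUW|nU] := boolP (U <= W)%VS.
  rewrite big1 => [|B _]; last by rewrite mulmxA twistE sUW andbF mul0mx.
  by rewrite scaler0 subr0 (submx_trans (bvec_chains F sUW dU)) ?addsmxSl.
have [c cE] := sum_twist_untwist sUV nU.
under eq_bigr do rewrite mulmxA.
have hA := hyper_cap hW sUV nU.
rewrite cE dU scalerDr scalerA mulVf ?expfz_neq0 // scale1r opprD addNKr.
rewrite -scaleN1r !scalemx_sub // (submx_trans _ (addsmxSr _ _)) // submxMr //.
rewrite bvec_chains ?capvSr //; have := hyper_dim hA; clear -dU; lia.
Qed.

End Pair.

Variable m : nat.
Hypotheses (m_gt1 : (1 < m)%N) (qint_m : [m]_q = 0).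
Hypothesis qint_neq0 : forall i, (0 < i < m)%N -> [i]_q != 0.

Theorem exact_chains V : exact_on F m V.
Proof.
have [d] := ubnP (\dim V); elim: d V => // d IHd V ltd k i j r x i0 j0 ij cond xV xi0.
have [V0|V0] := eqVneq V 0%VS.
  (* For V = 0 the numerical condition excludes k = 0, so there are no chains in degree k. *)
  exists 0; rewrite ?sub0mx ?mul0mx //; apply/eqP; rewrite -submx0.
  rewrite (submx_trans xV) // chains_out ?submx0 //.
  by move: cond; rewrite V0 dimv0; clear -i0 j0; lia.
have neV0 : 0%VS != V by rewrite eq_sym.
have [W _ hW] := exists_hyper (sub0v V) neV0.
have dV := hyper_dim hW.
have exW : exact_on F m W by apply: IHd; clear -ltd dV; lia.
pose c := (q ^ ((\dim V)%:Z - k - 1))^-1.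
(* Phrased as an inclusion of row spaces, the goal is additive in x, so the two parts can be treated
   separately. *)
suff : (x <= chains V (k + j%:Z) *m bd ^+ j)%MS.
  case/submxP=> D ->; exists (D *m chains V (k + j%:Z)); rewrite ?submxMl //.
  by rewrite mulmxA.
have [/submxP[D xTE] xTi0] : (x *m twist_sum W V <= chains V (k + j%:Z) *m bd ^+ j)%MS
    /\ x *m twist_sum W V *m bd ^+ i = 0.
  rewrite mulmx_sumr mulmx_suml; split; [apply: summx_sub | apply: big1];
    move=> B /andP[hB neB]; rewrite mulmxA.
    have [hHB hHW] := hyper_pair hW hB neB.
    have zH := twist_chains B hW xV.
    have zi0 : x *m twist B W V *m bd ^+ i = 0.
      apply/eqP; have := twist_bdX q_neq0 hW hB i xV.
      by rewrite xi0 mul0mx => /esym/eqP; rewrite scaler_eq0 expf_eq0 (negPf q_neq0) andbF.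
    have dH := hyper_dim hHW.
    have ltH : (\dim (B :&: W) < d)%N by clear -ltd dV dH; lia.
    (* The condition depends on the degree only through 2k - dim, which is the same for B :&: W in
       degree k - 1. *)
    have condH : (2 * (k - 1) + j%:Z <= (\dim (B :&: W))%:Z)
        || ((\dim (B :&: W))%:Z <= 2 * (k - 1) - i%:Z).
      by move: cond; clear -dV dH; lia.
    have [w wH wE] := IHd _ ltH _ _ _ _ _ i0 j0 ij condH zH zi0.
    rewrite wE -(untwist_bdX q_neq0 hW hB neB _ wH) submxMr //.
    have -> : k + j%:Z = k - 1 + j%:Z + 1 by clear; lia.
    exact: untwist_chains.
  have zH := twist_chains B hW xV.
  rewrite (untwist_bdX q_neq0 hW hB neB _ zH).
  apply/eqP; have := twist_bdX q_neq0 hW hB i xV.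
  rewrite xi0 mul0mx => /esym/eqP; rewrite scaler_eq0 expf_eq0 (negPf q_neq0) andbF.
  by move/eqP->; rewrite mul0mx.
have /sub_addsmxP[[u1 u2] /= xE] := twist_sum_chains hW xV.
set x' := x - _ in xE; rewrite mulmxA in xE.
have x'i0 : x' *m bd ^+ i = 0.
  by rewrite mulmxBl xi0 -scalemxAl xTi0 scaler0 subr0.
rewrite xE in x'i0.
have [z zV zE] := cone_exact q_neq0 m_gt1 qint_m qint_neq0 hW exW i0 j0 ij
  (submxMl u1 _) (submxMl u2 _) cond x'i0.
have -> : x = x' + c *: (x *m twist_sum W V) by rewrite subrK.
by rewrite xE zE xTE addmx_sub ?submxMr // scalemx_sub // submxMl.
Qed.

End Inversion.

(** * Classes in the Grothendieck group *)

Section Groth.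
Variables (F : fieldType) (gT : finGroupType) (G : {group gT}).

Lemma groth_class_ses d1 d2 d3 (r1 : mx_representation F G d1)
    (r2 : mx_representation F G d2) (r3 : mx_representation F G d3) :
  short_exact (fgmod_of r1) (fgmod_of r2) (fgmod_of r3) ->
  groth_class r2 = groth_class r1 + groth_class r3.
Proof.
move/ses_relation_gen/asboolP => ses; apply/eqP; rewrite -subr_eq0 opprD addrA.
rewrite /groth_class -!raddfB /=; apply/eqP.
have : << fgmod_of r2 >> - << fgmod_of r1 >> - << fgmod_of r3 >>
    == 0 %[mod Quotient.quot (@ses_pred F gT G)]%qT.
  by rewrite -Quotient.idealrBE subr0.
by move/eqP->; rewrite raddf0.
Qed.

Lemma val_submodM n (U : 'M[F]_n) p r (A : 'M_(p, r)) (W : 'M_(r, \rank U)) :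
  val_submod (A *m W) = A *m val_submod W.
Proof. by rewrite /val_submod /= mulmxA. Qed.

(** The sequence 0 -> V :&: ker f -> V -> V f -> 0 is written in the coordinates of the submodules;
    exactness in the middle follows from one inclusion and a rank count. *)
Lemma groth_class_image n1 n2 (r1 : mx_representation F G n1)
    (r2 : mx_representation F G n2) (f : 'M_(n1, n2)) (U V : 'M_n1) (X : 'M_n2)
    (modU : mxmodule r1 U) (modV : mxmodule r1 V) (modX : mxmodule r2 X) :
    {in G, forall x, r1 x *m f = f *m r2 x} ->
    (U :=: V :&: kermx f)%MS -> (X :=: V *m f)%MS ->
  groth_class (submod_repr modV)
    = groth_class (submod_repr modU) + groth_class (submod_repr modX).
Proof.
move=> fJ UE XE; apply: groth_class_ses.
have sUV : (val_submod (1%:M : 'M_(\rank U)) <= V)%MS by rewrite val_submod1 UE capmxSl.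
have sUf : (val_submod (1%:M : 'M_(\rank U)) <= kermx f)%MS.
  by rewrite val_submod1 UE capmxSr.
have VE : (val_submod (1%:M : 'M_(\rank V)) *m f :=: X)%MS.
  by apply: eqmx_trans (eqmx_sym XE); apply: eqmxMr; apply: val_submod1.
have sVX : (val_submod (1%:M : 'M_(\rank V)) *m f <= X)%MS by rewrite VE.
pose g := in_submod V (val_submod (1%:M : 'M_(\rank U))).
pose h := in_submod X (val_submod (1%:M : 'M_(\rank V)) *m f).
have rg : \rank g = \rank U by rewrite mxrank_in_submod // val_submod1.
have rh : \rank h = \rank X by rewrite mxrank_in_submod // VE.
exists g, h; split=> [x Gx|x Gx|||] /=.
- apply: (@val_submod_inj F n1 V); rewrite val_submodJ // val_submodM !in_submodK //.
  by rewrite -val_submodE -val_submodJ // mul1mx.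
- apply: (@val_submod_inj F n2 X); rewrite val_submodJ // val_submodM !in_submodK //.
  by rewrite mulmxA -val_submodE -mulmxA -fJ // mulmxA -val_submodJ // mul1mx.
- by rewrite /row_free rg.
- by rewrite /row_full rh.
have gh0 : (g <= kermx h)%MS.
  apply/sub_kermxP/(@val_submod_inj F n2 X).
  rewrite val_submodM in_submodK // mulmxA -val_submodE in_submodK // linear0.
  exact/sub_kermxP.
rewrite -(mxrank_leqif_eq gh0) rg mxrank_ker rh UE XE.
by rewrite -[X in (X - _)%N](mxrank_mul_ker V f) addKn.
Qed.

Section Submodules.
Variables (d : nat) (rG : mx_representation F G d).
Implicit Types U V X : 'M[F]_d.

(** The image formula with all three modules zero reads [U] = [U] + [U]. *)
Lemma groth_class0 U (modU : mxmodule rG U) :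
  U = 0 -> groth_class (submod_repr modU) = 0.
Proof.
move=> U0; have fJ : {in G, forall x, rG x *m (0 : 'M_d) = 0 *m rG x}.
  by move=> x _; rewrite mulmx0 mul0mx.
have UE : (U :=: U :&: kermx (0 : 'M_d))%MS by rewrite U0 cap0mx.
have XE : (U :=: U *m 0)%MS by rewrite U0 mul0mx.
have /eqP := groth_class_image modU modU modU fJ UE XE.
by rewrite -subr_eq0 opprD addrA subrr sub0r oppr_eq0 => /eqP.
Qed.

Lemma groth_class_eqmx U V (modU : mxmodule rG U) (modV : mxmodule rG V) :
  (U :=: V)%MS -> groth_class (submod_repr modU) = groth_class (submod_repr modV).
Proof.
move=> UV; have fJ : {in G, forall x, rG x *m 1%:M = 1%:M *m rG x}.
  by move=> x _; rewrite mulmx1 mul1mx.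
have mod0 : mxmodule rG (0 : 'M_d) by apply: mxmodule0.
rewrite (groth_class_image mod0 modU modV fJ) ?(groth_class0 mod0) ?add0r //.
  by rewrite (eqP (_ : kermx 1%:M == 0)) ?capmx0 // kermx_eq0 row_free_unit unitmx1.
by rewrite mulmx1; apply: eqmx_sym.
Qed.

(** The image formula is applied to the projection modulo U, restricted to V. *)
Lemma groth_class_section U V (modU : mxmodule rG U) (modV : mxmodule rG V) :
  (U <= V)%MS -> groth_class (submod_repr modV)
    = groth_class (submod_repr modU) + groth_class (section_repr modU modV).
Proof.
move=> sUV.
apply: (@groth_class_image _ _ rG (factmod_repr modU) (in_factmod U 1%:M)).
- by move=> x Gx; rewrite -in_factmodE -{1}[rG x]mul1mx in_factmodJ.
- apply/eqmxP/andP; split.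
    by rewrite sub_capmx sUV; apply/sub_kermxP/eqP; rewrite -in_factmodE in_factmod_eq0.
  rewrite -in_factmod_eq0 in_factmodE; apply/eqP/sub_kermxP; exact: capmxSr.
by rewrite -in_factmodE; apply: genmxE.
Qed.

End Submodules.
End Groth.

(** * Finitely supported sums over the integers and telescoping *)

Section IntSums.
Variable R : zmodType.
Implicit Types f g b : int -> R.

Lemma fsbig_int_range f (N : nat) : (forall t, ~~ (- N%:Z <= t < N%:Z) -> f t = 0) ->
  \sum_(t \in [set: int]%classic) f t = \sum_(0 <= j < N + N) f (j%:Z - N%:Z).
Proof.
move=> f0; pose h (j : nat) : int := j%:Z - N%:Z.
have h_inj : injective h by move=> j l /addIr [].
rewrite -(big_map h xpredT f) [RHS]fsbig_seq; last by rewrite map_inj_uniq ?iota_uniq.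
apply/esym/fsbig_widen => // t [_ nt]; apply: f0; apply/negP=> tN; apply: nt.
rewrite /=; apply/mapP; exists `|((t : int) + N%:Z)%R|%N;
  by rewrite ?mem_index_iota /h; move: (t : int) tN; lia.
Qed.

(** Here f1 and f2 stand for the two families of chain modules, g for cycles, b and b' for
    boundaries. Then f1 t - f2 t = (g t - b t) + (b t - b (t - 1)): the second bracket telescopes
    and the first is supported at t = 0. *)
Lemma sum_int_telescope (N : nat) f1 f2 g b b' : (0 < N)%N ->
    (forall t, ~~ (- N%:Z <= t < N%:Z - 1) -> [/\ f1 t = 0, f2 t = 0 & b t = 0]) ->
    (forall t, f1 t = g t + b' t) -> (forall t, f2 t = b' t + b (t - 1)) ->
    (forall t, t != 0 -> g t = b t) ->
  \sum_(t \in [set: int]%classic) f1 t - \sum_(t \in [set: int]%classic) f2 t = g 0 - b 0.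
Proof.
move=> N_gt0 supp f1E f2E gE.
have suppW t : ~~ (- N%:Z <= t < N%:Z) -> ~~ (- N%:Z <= t < N%:Z - 1) by lia.
rewrite !(@fsbig_int_range _ N); try by move=> t /suppW/supp[].
rewrite -sumrB.
pose u (j : nat) := b (j%:Z - N%:Z - 1).
rewrite (eq_bigr (fun j : nat => (g (j%:Z - N%:Z) - b (j%:Z - N%:Z)) + (u j.+1 - u j))).
  rewrite big_split /= telescope_sumr // /u.
  (* The upper end of the telescope is b at N - 1, which is why the support hypothesis stops one
     short of N. *)
  have [_ _ ->] := supp ((N + N)%:Z - N%:Z - 1) (ltac:(lia)).
  have [_ _ ->] := supp (0%:Z - N%:Z - 1) (ltac:(lia)).
  rewrite subrr addr0 big_mkord.
  have ltN : (N < N + N)%N by lia.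
  rewrite (bigD1 (Ordinal ltN)) //= subrr big1 ?addr0 // => j neq.
  rewrite gE ?subrr // subr_eq0; apply: contra neq => /eqP[jN].
  by apply/eqP/val_inj.
move=> j _; have -> : u j.+1 = b (j%:Z - N%:Z) by rewrite /u; congr b; lia.
by rewrite f1E f2E addrA subrK opprD addrA addrK.
Qed.
End IntSums.

(** * The Euler characteristic *)

Section Homology.
Variables (F : fieldType) (K : finFieldType) (n m : nat).
Local Notation q := (#|{: K}|%:R : F).
Local Notation "[ i ]_q" := (qint F #|{: K}| i).
Hypothesis q_neq0 : q != 0.
Hypotheses (m_gt1 : (1 < m)%N) (qint_m : [m]_q = 0).
Hypothesis qint_neq0 : forall i, (0 < i < m)%N -> [i]_q != 0.
Implicit Types (k : int) (i j : nat).

Local Notation clM k := (groth_class (M_repr F K n k)).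
Local Notation clZ k i := (groth_class (submod_repr (cycles_module F K n k i))).
Local Notation clB k j := (groth_class (submod_repr (boundaries_module F K n k j))).

Lemma boundaries_sub_cycles k i j : (i + j = m)%N ->
  (boundaries F K n k j <= cycles F K n k i)%MS.
Proof.
move=> ij; rewrite sub_capmx; apply/andP; split.
  apply/sub_kermxP; rewrite -mulmxXD addnC ij.
  by rewrite (bdX_eq0 n q_neq0 m_gt1 qint_m) mulmx0.
rewrite /boundaries -!chains_full; apply: submx_trans (bdX_chains j (submx_refl _)) _.
by rewrite addrK.
Qed.

(** Exactness is applied to the full space, with the matrix of all cycles as x. *)
Lemma cycles_eq_boundaries k i j : (0 < i)%N -> (0 < j)%N -> (i + j = m)%N ->
    (2 * k + j%:Z <= n%:Z) || (n%:Z <= 2 * k - i%:Z) ->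
  (cycles F K n k i :=: boundaries F K n k j)%MS.
Proof.
move=> i0 j0 ij cond; apply/eqmxP; rewrite boundaries_sub_cycles // andbT.
have dimV : \dim (fullv : {vspace 'rV[K]_n}) = n.
  by rewrite dimvf dim_matrix; exact: mul1n.
have ex : exact_on F m (fullv : {vspace 'rV[K]_n}) by exact: exact_chains.
have sV : (cycles F K n k i <= chains F fullv k)%MS by rewrite chains_full capmxSr.
have Zi0 : cycles F K n k i *m bd F K n ^+ i = 0 by apply/sub_kermxP; exact: capmxSl.
rewrite -dimV in cond; have [y yV ->] := ex _ _ _ _ _ i0 j0 ij cond sV Zi0.
by rewrite submxMr // -chains_full.
Qed.

(** The map bd^i on chains of degree k has the cycles as kernel and the boundaries in degree k - i
    as image. *)
Lemma groth_classM k i : clM k = clZ k i + clB (k - i%:Z) i.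
Proof.
apply: (groth_class_image (f := bd F K n ^+ i)).
- by move=> g Gg; rewrite (centgmxP (bdX_cent F K n i)).
- by rewrite /cycles capmxC.
by rewrite /boundaries subrK.
Qed.

Lemma groth_class_homology k i : (i <= m)%N ->
  groth_class (homology_repr F K n m k i) = clZ k i - clB k (m - i).
Proof.
move=> im; have sBZ : (boundaries F K n k (m - i) <= cycles F K n k i)%MS.
  by apply: boundaries_sub_cycles; rewrite subnKC.
have -> := groth_class_section (boundaries_module F K n k (m - i))
  (cycles_module F K n k i) sBZ.
by rewrite addrC addKr.
Qed.

Lemma M_out k : ~~ (0 <= k <= n%:Z) -> M F K n k = 0.
Proof.
move=> nk; rewrite -chains_full chains_out //.
by rewrite dimvf dim_matrix [X in ~~ (_ <= _ <= X%:Z)]mul1n.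
Qed.

Lemma groth_classM_out k : ~~ (0 <= k <= n%:Z) -> clM k = 0.
Proof. by move=> nk; apply/groth_class0/M_out. Qed.

Lemma groth_classB_out k j : ~~ (0 <= k + j%:Z <= n%:Z) -> clB k j = 0.
Proof. by move=> nk; apply: groth_class0; rewrite /boundaries M_out ?mul0mx. Qed.

Lemma groth_class_homology_middle k i : middle_index n m k i ->
  groth_class (homology_repr F K n m k i) =
    \sum_(t \in [set: int]%classic) clM (k + t * m%:Z)
    - \sum_(t \in [set: int]%classic) clM (k - i%:Z + t * m%:Z).
Proof.
case=> /andP[k0 kn] /andP[i0 im] mid.
have ij : (i + (m - i) = m)%N by rewrite subnKC // ltnW.
have j0 : (0 < m - i)%N by rewrite subn_gt0.
rewrite (groth_class_homology k (ltnW im)); move: (m - i)%N ij j0 => j ij j0.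
have ji : (j + i = m)%N by rewrite addnC.
have mE : m%:Z = i%:Z + j%:Z by rewrite -ij.
have {}mid : n%:Z < 2 * k + j%:Z < n%:Z + m%:Z.
  by move: mid; clear -mE; lia.
(* For t outside this window all degrees involved fall outside 0..n, even after shifts by up to
   m. *)
have big t : ~~ (- (n + m)%N.+2%:Z <= t < (n + m)%N.+2%:Z - 1) -> 
    (t * m%:Z < - (n + m + m)%N%:Z) \/ ((n + m + m)%N%:Z < t * m%:Z).
  by clear -m_gt1; nia.
symmetry; rewrite -[in RHS](addr0 k) -(mul0r m%:Z).
apply: (@sum_int_telescope _ (n + m).+2 _ _ (fun t => clZ (k + t * m%:Z) i)
  (fun t => clB (k + t * m%:Z) j) (fun t => clB (k - i%:Z + t * m%:Z) i)) => //.
- move=> t /big tb; split; [apply: groth_classM_out..|apply: groth_classB_out];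
    by move: (t * m%:Z) tb; clear -k0 kn mE; lia.
- move=> t; rewrite (groth_classM _ i).
  by congr (_ + clB _ i); rewrite addrAC.
- move=> t; have ZB : (cycles F K n (k - i%:Z + t * m%:Z) j
      :=: boundaries F K n (k - i%:Z + t * m%:Z) i)%MS.
    apply: cycles_eq_boundaries => //.
    (* The degrees k - i + tm are never middle: the lower bound in [mid] handles t >= 1 and the
       upper bound handles t <= 0. *)
    by clear -mid mE i0 j0; have [t1|t0] := lerP 1 t; nia.
  rewrite (groth_classM _ j) (groth_class_eqmx _ (boundaries_module _ _ _ _ _) ZB).
  by congr (_ + clB _ j); rewrite mulrBl mul1r mE; clear; lia.
move=> t t0; apply: groth_class_eqmx; apply: cycles_eq_boundaries => //.
(* Among the degrees k + tm only t = 0 is middle. *)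
clear -mid mE i0 j0 t0; have [t1|t1] := lerP 1 t; nia.
Qed.

End Homology.

Local Open Scope classical_set_scope.

Theorem corollary4p3 (Fq : finFieldType) (F : fieldType) (p m n : nat)
    (k : int) (i : nat)
    (charF : p \in [pchar F])
    (p_ndvd_q : ~~ (p %| #|{: Fq}|)%N)
    (m_def : is_quantum_char F #|{: Fq}| m)
    (ki_middle : middle_index n m k i) :
  groth_class (homology_repr F Fq n m k i) =
    \sum_(t \in [set: int]) groth_class (M_repr F Fq n (k + t * m%:Z))
    - \sum_(t \in [set: int]) groth_class (M_repr F Fq n (k - i%:Z + t * m%:Z)).
Proof.
case: m_def => m_gt1 qint_m m_min.
have q_neq0 : #|{: Fq}|%:R != 0 :> F by rewrite -(dvdn_pcharf charF).
have qint_neq0 l : (0 < l < m)%N -> qint F #|{: Fq}| l != 0.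
  (* Minimality of m speaks only of indices above 1; for l = 1 the value is 1. *)
  case: l => [|[|l]] // lt_m; first by rewrite /qint big_ord1 expr0 oner_neq0.
  apply/eqP=> /(m_min l.+2 (ltn0Sn l)).
  by rewrite leqNgt; case/andP: lt_m => _ ->.
exact: groth_class_homology_middle.
Qed.
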